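(* Let $\mathbb{A}$ be an additive category. The absolute torsion $\tau^{NEW}$ of chain equivalences of signed chain complexes in $\mathbb{A}$ has the following properties. (1) If $f:C\to D$ and $g:D\to E$ are chain equivalences of signed chain complexes in $\mathbb{A}$, then $\tau^{NEW}(gf)=\tau^{NEW}(f)+\tau^{NEW}(g)\in K_1^{iso}(\mathbb{A})$. (2) If $f:C\to D$ is a chain map of contractible signed chain complexes, then $\tau^{NEW}(f)=\tau^{NEW}(D)-\tau^{NEW}(C)\in K_1^{iso}(\mathbb{A})$. (3) $\tau^{NEW}(f)$ is a chain homotopy invariant of $f$. (4) Suppose given a commutative diagram of chain maps of signed chain complexes with short exact rows $0\to A\xrightarrow{i}B\xrightarrow{j}C\to 0$ and $0\to A'\xrightarrow{i'}B'\xrightarrow{j'}C'\to 0$ and vertical maps $a:A\to A'$, $b:B\to B'$, $c:C\to C'$ which are chain equivalences (so $i'a=bi$, $j'b=cj$). Then $$\tau^{NEW}(b)=\tau^{NEW}(a)+\tau^{NEW}(c)-\tau^{NEW}(A,B,C;i,j)+\tau^{NEW}(A',B',C';i',j')\in K_1^{iso}(\mathbb{A}).$$ (5) For chain equivalences $f:C\to D$, $f':C'\to D'$ of signed chain complexes, the sum $f\oplus f':C\oplus C'\to D\oplus D'$ satisfies $\tau^{NEW}(f\oplus f')=\tau^{NEW}(f)+\tau^{NEW}(f')\in K_1^{iso}(\mathbb{A})$. (6) If $0\to A\xrightarrow{f}B\xrightarrow{g}C\to 0$ is a short exact sequence of signed chain complexes in which $C$ is contractible and $f$ is a chain equivalence,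 then $\tau^{NEW}(f)=\tau^{NEW}(A,B,C;f,g)+\tau^{NEW}(C)$.
   Context: $K_0(\mathbb{A})$ is the abelian group with one generator $[M]$ for each object $M$ and relations $[M]=[M']$ if $M\cong M'$, $[M\oplus N]=[M]+[N]$. $K_1^{iso}(\mathbb{A})$ is the abelian group with one generator $\tau^{iso}(f)$ for each isomorphism $f:M\to N$ in $\mathbb{A}$ and relations $\tau^{iso}(gf)=\tau^{iso}(f)+\tau^{iso}(g)$ (for $f:M\to N$, $g:N\to P$) and $\tau^{iso}(f\oplus f')=\tau^{iso}(f)+\tau^{iso}(f')$. For objects $X,Y$ put $\epsilon(X,Y)=\tau^{iso}\left(\begin{pmatrix}0&1_Y\\1_X&0\end{pmatrix}:X\oplus Y\to Y\oplus X\right)$. This depends only on stable isomorphism classes and extends to a homomorphism $\epsilon:K_0(\mathbb{A})\otimes K_0(\mathbb{A})\to K_1^{iso}(\mathbb{A})$. Chain complexes are finite complexes in $\mathbb{A}$ (indexed by $r\ge 0$). $C_{even}=C_0\oplus C_2\oplus\cdots$, $C_{odd}=C_1\oplus C_3\oplus\cdots$, $\chi(C)=[C_{even}]-[C_{odd}]\in K_0(\mathbb{A})$. The suspension $SC$ has $SC_r=C_{r-1}$, $SC_0=0$. For complexes $C,D$: $\beta(C,D)=\sum_{i>j}(\epsilon(C_{2i},D_{2j})-\epsilon(C_{2i+1},D_{2j+1}))\in K_1^{iso}(\mathbb{A})$. A signed chain complex is a pair $(C,\eta_C)$ (written $C$) with $C$ a finite chain complex in $\mathbb{A}$ and $\eta_C\in\mathrm{Im}(\epsilon)$.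 Signs of suspensions and sums: $\eta_{SC}=-\eta_C$, $\eta_{C\oplus D}=\eta_C+\eta_D-\beta(C,D)+\epsilon(C_{odd},\chi(D))$. For a collection of isomorphisms $f=\{f_r:C_r\to D_r\}$ between the chain objects of signed complexes (not necessarily a chain map), $\tau^{NEW}_{iso}(f)=\sum_r(-1)^r\tau^{iso}(f_r)-\eta_C+\eta_D\in K_1^{iso}(\mathbb{A})$. For a contractible signed complex $C$ with chain contraction $\Gamma:C_r\to C_{r+1}$, $\tau(C)=\tau^{iso}(d+\Gamma:C_{odd}\to C_{even})$ (independent of $\Gamma$), and $\tau^{NEW}(C)=\tau(C)+\eta_C$. A short exact sequence $0\to C\xrightarrow{i}C''\xrightarrow{j}C'\to 0$ of signed complexes is a sequence of chain maps which is split exact in each degree. Choosing $k:C'_r\to C''_r$ with $jk=1$ for each $r$ (such that $(i\ k):C_r\oplus C'_r\to C''_r$ is an isomorphism), its absolute torsion is $\tau^{NEW}(C,C'',C';i,j)=\tau^{NEW}_{iso}((i\ k):C_r\oplus C'_r\to C''_r)$, where the source is the signed complex $C\oplus C'$; this is independent of the choice of the $k$. The algebraic mapping cone of a chain map $f:C\to D$ is $\mathcal{C}(f)_r=D_r\oplus C_{r-1}$ with $d=\begin{pmatrix}d_D&(-1)^{r+1}f\\0&d_C\end{pmatrix}$ and sign $\eta_{\mathcal{C}(f)}=\eta_{D\oplus SC}$. The absolute torsion of a chain equivalence $f:C\to D$ of signed complexes is $\tau^{NEW}(f)=\tau^{NEW}(\mathcal{C}(f))\in K_1^{iso}(\ma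thbb{A})$.
   Formalization: In K_1^iso the associativity and unit isomorphisms of ⊕ are also given torsion 0; this is automatic when ⊕ is strictly associative and unital, and without it ε need not be bilinear on K_0, so the signs would be undefined. *)

(* Defs.v *)
From HB Require Import structures.
From mathcomp Require Import all_boot all_algebra.
From mathcomp Require Import boolp.
From mathcomp.multinomials Require Import freeg.

Set Implicit Arguments.
Unset Strict Implicit.
Unset Printing Implicit Defensive.

Import GRing.Theory.
Local Open Scope ring_scope.

(* The abelian group with generators T and relators rel, as the quotient of   *)
(* the free abelian group {freeg T} by the subgroup generated by rel.         *)
Section Presentation.
Variables (T : Type) (rel : {freeg {classic T}} -> Prop).

Inductive in_span : {freeg {classic T}} -> Prop :=
| span_rel u of rel u : in_span u
| span0 : in_span 0
| spanB u v of in_span u & in_span v : in_span (u - v).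

Definition span_pred : {pred {freeg {classic T}}} := fun u => `[< in_span u >].

Lemma span_zmod_closed : zmod_closed span_pred.
Proof.
split=> [|u v /asboolP hu /asboolP hv]; apply/asboolP; first exact: span0.
exact: spanB.
Qed.

HB.instance Definition _ :=
  GRing.isZmodClosed.Build {freeg {classic T}} span_pred span_zmod_closed.

Definition presented : zmodType := Quotient.quot span_pred.

Definition ppi (u : {freeg {classic T}}) : presented :=
  (\pi_(Quotient.quot span_pred) u)%qT.

Definition pgen (t : T) : presented := ppi << (t : {classic T}) >>.

(* The homomorphism extending phi when phi respects the relators              *)
(* (plift_is_additive, plift_gen).                                            *)
Definition plift (G : zmodType) (phi : T -> G) (q : presented) : G :=
  fglift (phi : {classic T} -> zmodule G) (repr (q : Quotient.quot span_pred)).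

Lemma ppiB u v : ppi (u - v) = ppi u - ppi v.
Proof. by rewrite /ppi !piE. Qed.

Lemma ppi0 : ppi 0 = 0.
Proof. by rewrite -[X in ppi X](subrr 0) ppiB subrr. Qed.

Lemma ppiD u v : ppi (u + v) = ppi u + ppi v.
Proof. by rewrite -{1}[v]opprK -[- v]sub0r !ppiB ppi0 sub0r opprK. Qed.

Lemma ppi_surj x : exists u, x = ppi u.
Proof.
by exists (repr (x : Quotient.quot span_pred)); rewrite /ppi reprK.
Qed.

Lemma ppi_eq u v : ppi u = ppi v -> in_span (u - v).
Proof. by move/eqP; rewrite -Quotient.idealrBE => /asboolP. Qed.

Lemma ppi_rel u : rel u -> ppi u = 0.
Proof.
move=> hu; rewrite -ppi0; apply/eqP.
by rewrite -Quotient.idealrBE subr0; apply/asboolP/span_rel.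
Qed.

Lemma pgen_sum x y z : rel (<< (x : {classic T}) >>
    - (<< (y : {classic T}) >> + << (z : {classic T}) >>)) ->
  pgen x = pgen y + pgen z.
Proof.
by move/ppi_rel; rewrite ppiB ppiD => /eqP; rewrite subr_eq0 => /eqP.
Qed.

Section Lift.
Variables (G : zmodType) (phi : T -> G).
Let F : {freeg {classic T}} -> zmodule G :=
  fglift (phi : {classic T} -> zmodule G).
Hypothesis phi_rel : forall u, rel u -> F u = 0.

Let FB u v : F (u - v) = F u - F v.
Proof. exact: lift_is_additive. Qed.

Let F_span u : in_span u -> F u = 0.
Proof.
elim=> {u} [u /phi_rel //||u v _ hu _ hv]; last by rewrite FB hu hv subr0.
by have := FB 0 0; rewrite !subrr.
Qed.

Let plift_ppi u : plift phi (ppi u) = F u.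
Proof.
have /ppi_eq/F_span : ppi (repr (ppi u : Quotient.quot span_pred)) = ppi u.
  by rewrite /ppi reprK.
by rewrite FB => /eqP; rewrite subr_eq0 => /eqP.
Qed.

Lemma plift_is_additive x y : plift phi (x - y) = plift phi x - plift phi y.
Proof.
have [[u ->] [v ->]] := (ppi_surj x, ppi_surj y).
by rewrite -ppiB !plift_ppi FB.
Qed.

Lemma plift_gen t : plift phi (pgen t) = phi t.
Proof. by rewrite plift_ppi /F liftU scale1r. Qed.

End Lift.

Lemma presented_ind (P : presented -> Prop) :
  P 0 -> (forall t, P (pgen t)) -> (forall x y, P x -> P y -> P (x - y)) ->
  forall x, P x.
Proof.
move=> P0 Pg PB x; have [u ->] := ppi_surj x.
pose Q u := P (ppi u); rewrite -/(Q u).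
have QB v w : Q v -> Q w -> Q (v - w) by rewrite /Q ppiB; apply: PB.
have Q0 : Q 0 by rewrite /Q ppi0.
have QN v : Q v -> Q (- v) by move=> hv; rewrite -sub0r; apply: QB.
have QD v w : Q v -> Q w -> Q (v + w).
  by move=> hv hw; rewrite -[w]opprK; apply: QB => //; apply: QN.
have Qn v n : Q v -> Q (v *+ n).
  by move=> hv; elim: n => [//|n IH]; rewrite mulrS; apply: QD.
rewrite -(freeg_sumE u); elim/big_ind: _ => // z _.
have Qz : Q << z >> by apply: Pg.
case: (coeff z u) => n; first by have := Qn _ n Qz; rewrite freegU_muln natz.
rewrite NegzE -freegUN; apply: QN.
by have := Qn _ n.+1 Qz; rewrite freegU_muln natz.
Qed.

End Presentation.

(* An additive category with chosen zero object and chosen binary direct sums *)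
Record addCat : Type := AddCat {
  obj :> Type;
  hom : obj -> obj -> zmodType;
  idm : forall X, hom X X;
  comp : forall X Y Z, hom Y Z -> hom X Y -> hom X Z;
  compA : forall W X Y Z (h : hom Y Z) (g : hom X Y) (f : hom W X),
    comp h (comp g f) = comp (comp h g) f;
  comp1m : forall X Y (f : hom X Y), comp (idm Y) f = f;
  compm1 : forall X Y (f : hom X Y), comp f (idm X) = f;
  compDl : forall X Y Z (g g' : hom Y Z) (f : hom X Y),
    comp (g + g') f = comp g f + comp g' f;
  compDr : forall X Y Z (g : hom Y Z) (f f' : hom X Y),
    comp g (f + f') = comp g f + comp g f';
  zob : obj;
  idm_zob : idm zob = 0;
  osum : obj -> obj -> obj;
  inj1 : forall X Y, hom X (osum X Y);
  inj2 : forall X Y, hom Y (osum X Y);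
  prj1 : forall X Y, hom (osum X Y) X;
  prj2 : forall X Y, hom (osum X Y) Y;
  prj1_inj1 : forall X Y, comp (prj1 X Y) (inj1 X Y) = idm X;
  prj2_inj2 : forall X Y, comp (prj2 X Y) (inj2 X Y) = idm Y;
  prj1_inj2 : forall X Y, comp (prj1 X Y) (inj2 X Y) = 0;
  prj2_inj1 : forall X Y, comp (prj2 X Y) (inj1 X Y) = 0;
  inj_prj : forall X Y,
    comp (inj1 X Y) (prj1 X Y) + comp (inj2 X Y) (prj2 X Y) = idm (osum X Y)
}.

Arguments idm {a} X.
Arguments comp {a X Y Z} g f : rename.
Arguments zob {a}.
Arguments osum {a} X Y.
Arguments inj1 {a X Y}.
Arguments inj2 {a X Y}.
Arguments prj1 {a X Y}.
Arguments prj2 {a X Y}.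

Notation "g \oc f" := (comp g f) (at level 40, left associativity).
Notation "X \(+) Y" := (osum X Y) (at level 50, left associativity).

Section Category.
Variable A : addCat.
Implicit Types W X Y Z M N P : A.

Definition is_iso X Y (f : hom X Y) : Prop :=
  exists g : hom Y X, g \oc f = idm X /\ f \oc g = idm Y.

Definition isomorphic X Y : Prop := exists f : hom X Y, is_iso f.

(* The morphism with matrix (f g) *)
Definition row2 X Y Z (f : hom X Z) (g : hom Y Z) : hom (X \(+) Y) Z :=
  f \oc prj1 + g \oc prj2.

(* The morphism with matrix  ( a b )  *)
(*                           ( c d )  *)
Definition mx22 X Y X' Y' (a : hom X X') (b : hom Y X')
    (c : hom X Y') (d : hom Y Y') : hom (X \(+) Y) (X' \(+) Y') :=
  inj1 \oc row2 a b + inj2 \oc row2 c d.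

Definition msum X Y X' Y' (f : hom X X') (g : hom Y Y') :
  hom (X \(+) Y) (X' \(+) Y') := mx22 f 0 0 g.

Definition swap X Y : hom (X \(+) Y) (Y \(+) X) :=
  mx22 0 (idm Y) (idm X) 0.

Definition assoc X Y Z : hom ((X \(+) Y) \(+) Z) (X \(+) (Y \(+) Z)) :=
  inj1 \oc prj1 \oc prj1 + inj2 \oc (inj1 \oc prj2 \oc prj1 + inj2 \oc prj2).

(* The objects which equal 0 once direct sums are read as strictly unital *)
Inductive is_zero : A -> Prop :=
| is_zero_zob : is_zero zob
| is_zero_osum X Y of is_zero X & is_zero Y : is_zero (X \(+) Y).

Inductive K0_rel : {freeg {classic (obj A)}} -> Prop :=
| K0_iso M N of isomorphic M N :
    K0_rel (<< (M : {classic (obj A)}) >> - << (N : {classic (obj A)}) >>)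
| K0_sum M N :
    K0_rel (<< (M \(+) N : {classic (obj A)}) >>
            - (<< (M : {classic (obj A)}) >> + << (N : {classic (obj A)}) >>)).

Definition K0 : zmodType := presented K0_rel.
Definition cls (M : A) : K0 := pgen K0_rel M.

Record iso_gen := IsoGen {
  gsrc : A;
  gtgt : A;
  gmor : hom gsrc gtgt;
  gmor_iso : is_iso gmor }.

Definition fgen X Y (f : hom X Y) (hf : is_iso f) : {freeg {classic iso_gen}} :=
  << (IsoGen hf : {classic iso_gen}) >>.

(* K1_comp and K1_sum are the defining relations of K_1^iso. As usual in this *)
(* context M (+) N is treated as strictly associative with strict unit 0;     *)
(* the relations K1_assoc, K1_unitr, K1_unitl express this for arbitrary      *)
(* chosen direct sums. If the sums are strict, the morphisms involved are     *)
(* identities and these relations already follow from K1_comp. Without them   *)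
(* epsilon need not be bilinear, since the choice of M (+) N may be varied    *)
(* arbitrarily within its isomorphism class.                                  *)
Inductive K1_rel : {freeg {classic iso_gen}} -> Prop :=
| K1_comp M N P (f : hom M N) (g : hom N P)
    (hf : is_iso f) (hg : is_iso g) (hgf : is_iso (g \oc f)) :
    K1_rel (fgen hgf - (fgen hf + fgen hg))
| K1_sum M N M' N' (f : hom M N) (f' : hom M' N')
    (hf : is_iso f) (hf' : is_iso f') (hff' : is_iso (msum f f')) :
    K1_rel (fgen hff' - (fgen hf + fgen hf'))
| K1_assoc X Y Z (h : is_iso (assoc X Y Z)) : K1_rel (fgen h)
| K1_unitr X (h : is_iso (prj1 : hom (X \(+) zob) X)) : K1_rel (fgen h)
| K1_unitl X (h : is_iso (prj2 : hom (zob \(+) X) X)) : K1_rel (fgen h).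

Definition K1 : zmodType := presented K1_rel.

(* tau^iso; the value 0 at a non-isomorphism is a dummy *)
Definition tau1 X Y (f : hom X Y) : K1 :=
  if pselect (is_iso f) is left hf then pgen K1_rel (IsoGen hf) else 0.

Definition eps X Y : K1 := tau1 (swap X Y).

(* epsilon on K_0 (x) K_0; see eps0_cls, eps0Bl, eps0Br *)
Definition eps_r (M : A) (y : K0) : K1 := plift (fun N => eps M N) y.
Definition eps0 (x y : K0) : K1 := plift (fun M => eps_r M y) x.

(* The elements of K_0 (x) K_0 are the finite sums of pure tensors *)
Definition in_im_eps (u : K1) : Prop :=
  exists s : seq (K0 * K0), u = \sum_(p <- s) eps0 p.1 p.2.

Lemma comp0m X Y Z (f : hom X Y) : (0 : hom Y Z) \oc f = 0.
Proof. by apply: (addrI (0 \oc f)); rewrite -compDl !addr0. Qed.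

Lemma compm0 X Y Z (g : hom Y Z) : g \oc (0 : hom X Y) = 0.
Proof. by apply: (addrI (g \oc 0)); rewrite -compDr !addr0. Qed.

Lemma compNm X Y Z (g : hom Y Z) (f : hom X Y) : (- g) \oc f = - (g \oc f).
Proof. by apply: (addrI (g \oc f)); rewrite -compDl !subrr comp0m. Qed.

Lemma compmN X Y Z (g : hom Y Z) (f : hom X Y) : g \oc (- f) = - (g \oc f).
Proof. by apply: (addrI (g \oc f)); rewrite -compDr !subrr compm0. Qed.

Definition injprjE := (prj1_inj1, prj2_inj2, prj1_inj2, prj2_inj1).

Lemma p1i1A X Y Z (u : hom X Z) : u \oc prj1 \oc (inj1 : hom X (X \(+) Y)) = u.
Proof. by rewrite -compA prj1_inj1 compm1. Qed.
Lemma p2i2A X Y Z (u : hom Y Z) : u \oc prj2 \oc (inj2 : hom Y (X \(+) Y)) = u.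
Proof. by rewrite -compA prj2_inj2 compm1. Qed.
Lemma p1i2A X Y Z (u : hom X Z) : u \oc prj1 \oc (inj2 : hom Y (X \(+) Y)) = 0.
Proof. by rewrite -compA prj1_inj2 compm0. Qed.
Lemma p2i1A X Y Z (u : hom Y Z) : u \oc prj2 \oc (inj1 : hom X (X \(+) Y)) = 0.
Proof. by rewrite -compA prj2_inj1 compm0. Qed.

Definition catE := (compDl, compDr, compA, compNm, compmN, comp0m, compm0,
  comp1m, compm1, p1i1A, p2i2A, p1i2A, p2i1A, injprjE, add0r, addr0, oppr0).

Lemma sum_ext X Y Z (f g : hom (X \(+) Y) Z) :
  f \oc inj1 = g \oc inj1 -> f \oc inj2 = g \oc inj2 -> f = g.
Proof.
move=> h1 h2; rewrite -[f]compm1 -[g]compm1 -inj_prj !compDr !compA.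
by rewrite h1 h2.
Qed.

Lemma sum_coext X Y Z (f g : hom Z (X \(+) Y)) :
  prj1 \oc f = prj1 \oc g -> prj2 \oc f = prj2 \oc g -> f = g.
Proof.
move=> h1 h2; rewrite -[f]comp1m -[g]comp1m -inj_prj !compDl -!compA.
by rewrite h1 h2.
Qed.

Lemma mx22M X Y X' Y' X'' Y'' (a : hom X X') b c (d : hom Y Y')
    (a' : hom X' X'') b' c' (d' : hom Y' Y'') :
  mx22 a' b' c' d' \oc mx22 a b c d =
  mx22 (a' \oc a + b' \oc c) (a' \oc b + b' \oc d)
       (c' \oc a + d' \oc c) (c' \oc b + d' \oc d).
Proof.
by rewrite /mx22 /row2; apply: sum_coext; apply: sum_ext; rewrite !catE.
Qed.

Lemma mx22_0 X Y X' Y' :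
  mx22 0 0 0 0 = 0 :> hom (X \(+) Y) (X' \(+) Y').
Proof. by rewrite /mx22 /row2 !catE. Qed.

Lemma mx22_1 X Y : mx22 (idm X) 0 0 (idm Y) = idm (X \(+) Y).
Proof. by rewrite /mx22 /row2 !catE inj_prj. Qed.

Lemma is_iso_id X : is_iso (idm X).
Proof. by exists (idm X); rewrite comp1m. Qed.

Lemma is_iso_comp X Y Z (g : hom Y Z) (f : hom X Y) :
  is_iso g -> is_iso f -> is_iso (g \oc f).
Proof.
case=> g' [g'g gg'] [f' [f'f ff']]; exists (f' \oc g').
split; rewrite compA; first by rewrite -(compA f' g' g) g'g compm1.
by rewrite -(compA g f f') ff' compm1.
Qed.

Lemma is_iso_msum X Y X' Y' (f : hom X X') (g : hom Y Y') :
  is_iso f -> is_iso g -> is_iso (msum f g).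
Proof.
case=> f' [f'f ff'] [g' [g'g gg']]; exists (msum f' g').
by rewrite /msum !mx22M !catE f'f ff' g'g gg' !mx22_1.
Qed.

Lemma is_iso_swap X Y : is_iso (swap X Y).
Proof. by exists (swap Y X); rewrite /swap !mx22M !catE !mx22_1. Qed.

Definition assocV X Y Z : hom (X \(+) (Y \(+) Z)) ((X \(+) Y) \(+) Z) :=
  inj1 \oc (inj1 \oc prj1 + inj2 \oc prj1 \oc prj2) + inj2 \oc prj2 \oc prj2.

Lemma assocVK X Y Z : assocV X Y Z \oc assoc X Y Z = idm _.
Proof.
apply: sum_ext; first apply: sum_ext; apply: sum_coext;
  try (apply: sum_coext); by rewrite /assoc /assocV !catE.
Qed.

Lemma assocK X Y Z : assoc X Y Z \oc assocV X Y Z = idm _.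
Proof.
apply: sum_ext; [|apply: sum_ext]; apply: sum_coext;
  try (apply: sum_coext); by rewrite /assoc /assocV !catE.
Qed.

Lemma is_iso_assoc X Y Z : is_iso (assoc X Y Z).
Proof. by exists (assocV X Y Z); rewrite assocVK assocK. Qed.

Lemma is_iso_assocV X Y Z : is_iso (assocV X Y Z).
Proof. by exists (assoc X Y Z); rewrite assocVK assocK. Qed.

Lemma tau1E X Y (f : hom X Y) (hf : is_iso f) : tau1 f = pgen K1_rel (IsoGen hf).
Proof.
by rewrite /tau1; case: pselect => // h; rewrite (Prop_irrelevance h hf).
Qed.

Lemma tau1_comp X Y Z (g : hom Y Z) (f : hom X Y) : is_iso f -> is_iso g ->
  tau1 (g \oc f) = tau1 f + tau1 g.
Proof.
move=> hf hg; rewrite (tau1E hf) (tau1E hg) (tau1E (is_iso_comp hg hf)).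
exact/pgen_sum/K1_comp.
Qed.

Lemma tau1_sum X Y X' Y' (f : hom X X') (g : hom Y Y') : is_iso f -> is_iso g ->
  tau1 (msum f g) = tau1 f + tau1 g.
Proof.
move=> hf hg; rewrite (tau1E hf) (tau1E hg) (tau1E (is_iso_msum hf hg)).
exact/pgen_sum/K1_sum.
Qed.

Lemma tau1_id X : tau1 (idm X) = 0.
Proof.
by apply: (addrI (tau1 (idm X))); rewrite -tau1_comp ?comp1m ?addr0 //;
  exact: is_iso_id.
Qed.

Lemma tau1_assoc X Y Z : tau1 (assoc X Y Z) = 0.
Proof. by rewrite (tau1E (is_iso_assoc X Y Z)); exact/ppi_rel/K1_assoc. Qed.

Lemma eps_iso X X' Y Y' : isomorphic X X' -> isomorphic Y Y' ->
  eps X Y = eps X' Y'.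
Proof.
case=> f hf [g hg].
have : swap X' Y' \oc msum f g = msum g f \oc swap X Y.
  by rewrite /swap /msum !mx22M !catE.
move/(congr1 (@tau1 _ _)); rewrite !tau1_comp ?tau1_sum //;
  do ?[exact: is_iso_swap | exact: is_iso_msum].
by rewrite (addrC (tau1 g)) [RHS]addrC -/(eps _ _) => /addrI.
Qed.

Lemma epsC X Y : eps Y X = - eps X Y.
Proof.
apply/eqP; rewrite -addr_eq0 /eps -tau1_comp; do ?exact: is_iso_swap.
by rewrite /swap !mx22M !catE mx22_1 tau1_id.
Qed.

Lemma tau1_assocV X Y Z : tau1 (assocV X Y Z) = 0.
Proof.
have := tau1_comp (is_iso_assocV X Y Z) (is_iso_assoc X Y Z).
by rewrite assocK tau1_id tau1_assoc addr0.
Qed.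

Lemma mx22_inj1 X Y X' Y' a b c d :
  (mx22 a b c d : hom (X \(+) Y) (X' \(+) Y')) \oc inj1
  = inj1 \oc a + inj2 \oc c.
Proof. by rewrite /mx22 /row2 !catE. Qed.

Lemma mx22_inj2 X Y X' Y' a b c d :
  (mx22 a b c d : hom (X \(+) Y) (X' \(+) Y')) \oc inj2
  = inj1 \oc b + inj2 \oc d.
Proof. by rewrite /mx22 /row2 !catE. Qed.

Lemma swap_inj1 X Y : swap X Y \oc inj1 = inj2.
Proof. by rewrite mx22_inj1 compm0 compm1 add0r. Qed.

Lemma swap_inj2 X Y : swap X Y \oc inj2 = inj1.
Proof. by rewrite mx22_inj2 compm0 compm1 addr0. Qed.

Lemma msum_inj1 X Y X' Y' (f : hom X X') (g : hom Y Y') :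
  msum f g \oc inj1 = inj1 \oc f.
Proof. by rewrite mx22_inj1 compm0 addr0. Qed.

Lemma msum_inj2 X Y X' Y' (f : hom X X') (g : hom Y Y') :
  msum f g \oc inj2 = inj2 \oc g.
Proof. by rewrite mx22_inj2 compm0 add0r. Qed.

Lemma assoc_inj11 X Y Z : assoc X Y Z \oc inj1 \oc inj1 = inj1.
Proof. by rewrite /assoc !catE. Qed.

Lemma assoc_inj12 X Y Z : assoc X Y Z \oc inj1 \oc inj2 = inj2 \oc inj1.
Proof. by rewrite /assoc !catE. Qed.

Lemma assoc_inj2 X Y Z : assoc X Y Z \oc inj2 = inj2 \oc inj2.
Proof. by rewrite /assoc !catE. Qed.

Lemma assocV_inj1 X Y Z : assocV X Y Z \oc inj1 = inj1 \oc inj1.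
Proof. by rewrite /assocV !catE. Qed.

Lemma assocV_inj21 X Y Z : assocV X Y Z \oc inj2 \oc inj1 = inj1 \oc inj2.
Proof. by rewrite /assocV !catE. Qed.

Lemma assocV_inj22 X Y Z : assocV X Y Z \oc inj2 \oc inj2 = inj2.
Proof. by rewrite /assocV !catE. Qed.

Lemma swap_hexagon X Y Z : swap (X \(+) Y) Z =
  assoc Z X Y \oc msum (swap X Z) (idm Y) \oc assocV X Z Y
  \oc msum (idm X) (swap Y Z) \oc assoc X Y Z.
Proof.
apply: sum_ext; first apply: sum_ext.
- rewrite swap_inj1 -!compA (compA (assoc X Y Z)) assoc_inj11.
  rewrite msum_inj1 compm1 assocV_inj1 (compA (msum _ _)) msum_inj1.
  by rewrite -(compA inj1) swap_inj1 compA assoc_inj12.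
- rewrite swap_inj1 -!compA (compA (assoc X Y Z)) assoc_inj12.
  rewrite (compA (msum (idm X) _)) msum_inj2 -(compA inj2) swap_inj1.
  by rewrite (compA (assocV X Z Y)) assocV_inj22 msum_inj2 compm1 assoc_inj2.
- rewrite swap_inj2 -!compA assoc_inj2.
  rewrite (compA (msum (idm X) _)) msum_inj2 -(compA inj2) swap_inj2.
  rewrite (compA (assocV X Z Y)) assocV_inj21 (compA (msum _ _)) msum_inj1.
  by rewrite -(compA inj1) swap_inj2 compA assoc_inj11.
Qed.

Lemma epsDl X Y Z : eps (X \(+) Y) Z = eps X Z + eps Y Z.
Proof.
have i1 := is_iso_msum (is_iso_id X) (is_iso_swap Y Z).
have i2 := is_iso_msum (is_iso_swap X Z) (is_iso_id Y).
have i3 := is_iso_comp (is_iso_assoc Z X Y) i2.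
have i4 := is_iso_comp i3 (is_iso_assocV X Z Y).
rewrite {1}/eps swap_hexagon.
rewrite (tau1_comp (is_iso_assoc X Y Z) (is_iso_comp i4 i1)) (tau1_comp i1 i4).
rewrite (tau1_comp (is_iso_assocV X Z Y) i3) (tau1_comp i2 (is_iso_assoc Z X Y)).
rewrite !tau1_assoc tau1_assocV (tau1_sum (is_iso_id X) (is_iso_swap Y Z)).
rewrite (tau1_sum (is_iso_swap X Z) (is_iso_id Y)) !tau1_id.
by rewrite !add0r !addr0 addrC.
Qed.

Lemma epsDr X Y Z : eps X (Y \(+) Z) = eps X Y + eps X Z.
Proof. by rewrite epsC epsDl opprD -!epsC. Qed.

Section K0Lift.
Variables (G : zmodType) (phi : A -> G).
Hypothesis phi_iso : forall M N, isomorphic M N -> phi M = phi N.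
Hypothesis phi_sum : forall M N, phi (M \(+) N) = phi M + phi N.

Lemma K0_lift_rel u : K0_rel u ->
  fglift (phi : {classic (obj A)} -> zmodule G) u = 0.
Proof.
have FB := lift_is_additive (phi : {classic (obj A)} -> zmodule G).
case=> {u} [M N /phi_iso e|M N]; first by rewrite FB !liftU !scale1r e subrr.
by rewrite opprD addrA !FB !liftU !scale1r phi_sum addrAC addrK subrr.
Qed.

Lemma K0_lift_cls M : plift phi (cls M) = phi M.
Proof. exact: plift_gen K0_lift_rel M. Qed.

Lemma K0_liftB (x y : K0) : plift phi (x - y) = plift phi x - plift phi y.
Proof. exact: plift_is_additive K0_lift_rel x y. Qed.
End K0Lift.

Lemma isomorphic_refl X : isomorphic X X.
Proof. by exists (idm X); exact: is_iso_id. Qed.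

Let epsr_iso M N N' (h : isomorphic N N') : eps M N = eps M N'.
Proof. exact: eps_iso (isomorphic_refl M) h. Qed.

Lemma eps_r_iso z M M' : isomorphic M M' -> eps_r M z = eps_r M' z.
Proof.
move=> h; congr (plift _ z); apply/funext => N.
exact: eps_iso h (isomorphic_refl N).
Qed.

Lemma eps_r_sum z M M' : eps_r (M \(+) M') z = eps_r M z + eps_r M' z.
Proof.
rewrite /eps_r; elim/presented_ind: z => [|t|z z' hz hz'].
- rewrite -(subrr 0) !(K0_liftB (@epsr_iso _)) ?subrr ?addr0 //; exact: epsDr.
- rewrite -/(cls t) !(K0_lift_cls (@epsr_iso _)) ?epsDl //; exact: epsDr.
- rewrite !(K0_liftB (@epsr_iso _)) ?hz ?hz'; try exact: epsDr.
  by rewrite opprD addrACA.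
Qed.

Lemma eps0_clsl M y : eps0 (cls M) y = eps_r M y.
Proof. exact: K0_lift_cls (@eps_r_iso y) (@eps_r_sum y) M. Qed.

Lemma eps0_cls M N : eps0 (cls M) (cls N) = eps M N.
Proof. by rewrite eps0_clsl /eps_r (K0_lift_cls (@epsr_iso M) (@epsDr M)). Qed.

Lemma eps0Bl x y z : eps0 (x - y) z = eps0 x z - eps0 y z.
Proof. exact: K0_liftB (@eps_r_iso z) (@eps_r_sum z) x y. Qed.

Lemma eps0_0l y : eps0 0 y = 0.
Proof. by rewrite -(subrr 0) eps0Bl subrr. Qed.

Lemma eps0Br x y z : eps0 x (y - z) = eps0 x y - eps0 x z.
Proof.
elim/presented_ind: x => [|t|x x' hx hx'].
- by rewrite !eps0_0l subrr.
- by rewrite -/(cls t) !eps0_clsl /eps_r (K0_liftB (@epsr_iso t) (@epsDr t)).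
- rewrite !eps0Bl hx hx' [X in _ + X = _]opprD [X in _ = _ + X]opprD.
  exact: addrACA.
Qed.

Lemma in_im_epsD u v : in_im_eps u -> in_im_eps v -> in_im_eps (u + v).
Proof. by case=> s -> [t ->]; exists (s ++ t); rewrite big_cat. Qed.

Lemma in_im_epsN u : in_im_eps u -> in_im_eps (- u).
Proof.
case=> s ->; exists [seq (0 - p.1, p.2) | p <- s].
rewrite big_map; elim/big_rec2: _ => [|p a b _ <-]; first by rewrite oppr0.
by rewrite /= eps0Bl eps0_0l sub0r opprD.
Qed.

Lemma in_im_epsB u v : in_im_eps u -> in_im_eps v -> in_im_eps (u - v).
Proof. by move=> hu /in_im_epsN; apply: in_im_epsD. Qed.

Lemma in_im_eps_sum (I : Type) (r : seq I) (P : pred I) (F : I -> K1) :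
  (forall i, in_im_eps (F i)) -> in_im_eps (\sum_(i <- r | P i) F i).
Proof.
move=> hF; elim/big_ind: _ => //; last exact: in_im_epsD.
by exists [::]; rewrite big_nil.
Qed.

Lemma in_im_eps_eps0 x y : in_im_eps (eps0 x y).
Proof. by exists [:: (x, y)]; rewrite big_seq1. Qed.

Lemma in_im_eps_eps X Y : in_im_eps (eps X Y).
Proof. by rewrite -eps0_cls; exact: in_im_eps_eps0. Qed.

Fixpoint dsum (F : nat -> A) (n : nat) : A :=
  if n is n'.+1 then dsum F n' \(+) F n' else zob.

Fixpoint dcol (F : nat -> A) X (v : forall i, hom X (F i)) n : hom X (dsum F n) :=
  if n is n'.+1 then inj1 \oc dcol v n' + inj2 \oc v n' else 0.

Fixpoint drow (F : nat -> A) Y (v : forall j, hom (F j) Y) n : hom (dsum F n) Y :=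
  if n is n'.+1 then row2 (drow v n') (v n') else 0.

(* The morphism with matrix (m i j), i the row and j the column index *)
Definition dmx (F G : nat -> A) (m : forall i j, hom (F j) (G i)) n :
  hom (dsum F n) (dsum G n) := drow (fun j => dcol (fun i => m i j) n) n.

(* Finite chain complexes C_0 <- C_1 <- ..., with C_r = 0 for r >= clen *)
Record complex := Complex {
  cob :> nat -> A;
  cd : forall r, hom (cob r.+1) (cob r);
  cdd : forall r, cd r \oc cd r.+1 = 0;
  clen : nat;
  cfin : forall r, (clen <= r)%N -> is_zero (cob r) }.

(* The sums run over all degrees < 2 * clen; those >= clen contribute zeros *)
Definition ceven (C : complex) : A := dsum (fun i => C i.*2) (clen C).
Definition codd (C : complex) : A := dsum (fun i => C i.*2.+1) (clen C).

Definition chi (C : complex) : K0 := cls (ceven C) - cls (codd C).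

Definition beta (C D : complex) : K1 :=
  \sum_(i < clen C) \sum_(j < i)
    (eps (C i.*2) (D j.*2) - eps (C i.*2.+1) (D j.*2.+1)).

Record scomplex := SComplex {
  scx :> complex;
  eta : K1;
  eta_im : in_im_eps eta }.

Record chmap (C D : complex) := ChMap {
  cm :> forall r, hom (C r) (D r);
  cm_comm : forall r, cd D r \oc cm r.+1 = cm r \oc cd C r }.

Definition susp_ob (C : nat -> A) (r : nat) : A := if r is r'.+1 then C r' else zob.

Definition susp_d (C : complex) (r : nat) : hom (susp_ob C r.+1) (susp_ob C r) :=
  match r with 0 => 0 | r'.+1 => cd C r' end.

Lemma susp_dd C r : susp_d C r \oc susp_d C r.+1 = 0.
Proof. by case: r => [|r] /=; rewrite ?comp0m ?cdd. Qed.

Lemma susp_fin (C : complex) r : ((clen C).+1 <= r)%N -> is_zero (susp_ob C r).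
Proof. by case: r => [//|r h]; exact: (@cfin C r h). Qed.

Definition susp_cx (C : complex) : complex :=
  Complex (susp_dd C) (@susp_fin C).

Definition susp (C : scomplex) : scomplex :=
  @SComplex (susp_cx C) (- eta C) (in_im_epsN (eta_im C)).

Definition sum_d (C D : complex) (r : nat) :
  hom (C r.+1 \(+) D r.+1) (C r \(+) D r) := msum (cd C r) (cd D r).

Lemma sum_dd (C D : complex) r : sum_d C D r \oc sum_d C D r.+1 = 0.
Proof.
rewrite /sum_d /msum mx22M !comp0m !compm0 !cdd !addr0.
exact: mx22_0.
Qed.

Lemma max_fin (F G : nat -> A) m n :
  (forall r, (m <= r)%N -> is_zero (F r)) ->
  (forall r, (n <= r)%N -> is_zero (G r)) ->
  forall r, (maxn m n <= r)%N -> is_zero (F r \(+) G r).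
Proof.
by move=> hF hG r; rewrite geq_max => /andP[/hF ? /hG]; apply: is_zero_osum.
Qed.

Definition csum_cx (C D : complex) : complex :=
  Complex (sum_dd C D) (max_fin (@cfin C) (@cfin D)).

Definition eta_sum (C D : scomplex) : K1 :=
  eta C + eta D - beta C D + eps0 (cls (codd C)) (chi D).

Lemma eta_sum_im C D : in_im_eps (eta_sum C D).
Proof.
apply: in_im_epsD; last exact: in_im_eps_eps0.
apply: in_im_epsB; first exact: in_im_epsD (eta_im C) (eta_im D).
apply: in_im_eps_sum => i; apply: in_im_eps_sum => j.
by apply: in_im_epsB; apply: in_im_eps_eps.
Qed.

Definition csum (C D : scomplex) : scomplex :=
  @SComplex (csum_cx C D) (eta_sum C D) (eta_sum_im C D).

(* As cone_d C r starts in degree r.+1, the sign (-1)^(r+1) becomes (-1)^r.+2 *)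
Definition cone_d (C D : complex) (f : chmap C D) (r : nat) :
  hom (D r.+1 \(+) susp_ob C r.+1) (D r \(+) susp_ob C r) :=
  mx22 (cd D r) (f r *~ (-1) ^+ r.+2) 0 (susp_d C r).

Lemma cone_dd (C D : complex) (f : chmap C D) r :
  cone_d f r \oc cone_d f r.+1 = 0.
Proof.
rewrite mx22M cdd !comp0m !compm0 (susp_dd C r) !addr0.
have e : cd D r \oc (f r.+1 *~ (-1) ^+ r.+3) + f r *~ (-1) ^+ r.+2 \oc susp_d C r.+1 = 0.
  rewrite exprS mulN1r mulrNz compmN -signr_odd /=.
  case: (odd r); rewrite /= ?negbK ?expr0 ?expr1 ?mulrNz ?mulr1z.
    by rewrite compmN compNm opprK cm_comm subrr.
  by rewrite cm_comm addNr.
rewrite e; exact: mx22_0.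
Qed.

Definition cone_cx (C D : complex) (f : chmap C D) : complex :=
  Complex (cone_dd f) (max_fin (@cfin D) (@susp_fin C)).

Definition cone (C D : scomplex) (f : chmap C D) : scomplex :=
  @SComplex (cone_cx f) (eta (csum D (susp C))) (eta_im (csum D (susp C))).

Definition homotopic (C D : complex) (f g : chmap C D) : Prop :=
  exists h : forall r, hom (C r) (D r.+1),
    f 0%N - g 0%N = cd D 0 \oc h 0%N /\
    forall r, f r.+1 - g r.+1 = cd D r.+1 \oc h r.+1 + h r \oc cd C r.

Definition chid (C : complex) : chmap C C.
Proof. by exists (fun r => idm (C r)) => r; rewrite compm1 comp1m. Defined.

Definition chcomp (C D E : complex) (g : chmap D E) (f : chmap C D) : chmap C E.
Proof.
by exists (fun r => g r \oc f r) => r; rewrite compA cm_comm -!compA cm_comm.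
Defined.

Definition chsum (C D C' D' : complex) (f : chmap C D) (f' : chmap C' D') :
  chmap (csum_cx C C') (csum_cx D D').
Proof.
exists (fun r => msum (f r) (f' r)) => r.
by rewrite /= /sum_d /msum !mx22M !comp0m !compm0 !cm_comm !addr0.
Defined.

Definition chain_equiv (C D : complex) (f : chmap C D) : Prop :=
  exists g : chmap D C,
    homotopic (chcomp g f) (chid C) /\ homotopic (chcomp f g) (chid D).

Definition contraction (C : complex) (G : forall r, hom (C r) (C r.+1)) : Prop :=
  cd C 0 \oc G 0%N = idm (C 0%N) /\
  forall r, cd C r.+1 \oc G r.+1 + G r \oc cd C r = idm (C r.+1).

Definition contractible (C : complex) : Prop := exists G, @contraction C G.

Definition cast_ob X Y (e : X = Y) : hom X Y :=
  match e in _ = Z return hom X Z with erefl => idm X end.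

(* The component C_r -> C_s of d, resp. of G *)
Definition d_at (C : complex) (r s : nat) : hom (C r) (C s) :=
  if r =P s.+1 is ReflectT e then cd C s \oc cast_ob (congr1 C e) else 0.

Definition up_at (C : complex) (G : forall r, hom (C r) (C r.+1)) (r s : nat) :
  hom (C r) (C s) :=
  if r.+1 =P s is ReflectT e then cast_ob (congr1 C e) \oc G r else 0.

Definition d_plus (C : complex) (G : forall r, hom (C r) (C r.+1)) :
  hom (codd C) (ceven C) :=
  dmx (fun i j => d_at C j.*2.+1 i.*2 + up_at G j.*2.+1 i.*2) (clen C).

(* The torsion of a contractible complex, computed from some contraction; the *)
(* value 0 at a non-contractible complex is a dummy                           *)
Definition tau (C : complex) : K1 :=
  if pselect (contractible C) is left h then tau1 (d_plus (projT1 (cid h))) else 0.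

Definition tauN (C : scomplex) : K1 := tau C + eta C.

Definition tauN_map (C D : scomplex) (f : chmap C D) : K1 := tauN (cone f).

Definition tauN_iso (C D : scomplex) (f : forall r, hom (C r) (D r)) : K1 :=
  \sum_(r < maxn (clen C) (clen D)) tau1 (f r) *~ (-1) ^+ r - eta C + eta D.

(* 0 -> C -i-> C'' -j-> C' -> 0 is split exact in each degree *)
Definition short_exact (C C'' C' : complex) (i : chmap C C'') (j : chmap C'' C') :
  Prop :=
  forall r, j r \oc i r = 0 /\
    exists (l : hom (C'' r) (C r)) (k : hom (C' r) (C'' r)),
      [/\ l \oc i r = idm (C r), j r \oc k = idm (C' r) &
          i r \oc l + k \oc j r = idm (C'' r)].

(* Some k with j k = 1; the value 0 is a dummy *)
Definition section X Y (j : hom X Y) : hom Y X :=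
  if pselect (exists k, j \oc k = idm Y) is left h then projT1 (cid h) else 0.

Definition tauN_ses (C C'' C' : scomplex) (i : chmap C C'') (j : chmap C'' C') :
  K1 := @tauN_iso (csum C C') C'' (fun r => row2 (i r) (section (j r))).

End Category.

(* Main.v *)
Require Import Defs.
From mathcomp Require Import all_boot all_algebra.
From mathcomp Require Import zify boolp.
(* Imported again to take precedence over hom and section of the algebra library. *)
Import Defs.

Set Implicit Arguments.
Unset Strict Implicit.
Unset Printing Implicit Defensive.

Import GRing.Theory.
Local Open Scope ring_scope.

(** Absolute torsion is an additivity phenomenon, and everything follows from two
facts about contractible complexes: their torsion does not depend on the
contraction (dplusOE_dplusEO), and it is additive on short exact sequences, with
the absolute torsion of the sequence as correction (tauN_extension). The second
fact holds because a short exact sequence whose quotient is contractible splits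
by a chain map, which reduces it to direct sums, where the reordering of the
summands is compensated by the sign of the sum.

The remaining ingredient is formal. The sign of C (+) D is the sum of the signs
of C and D and of a bilinear expression in the eps(C_r, D_s). Two identities
between its coefficients suffice: exchanging C and D has absolute torsion
eps(chi C, chi D) (sum_sign_swap), and suspension reverses the expression up to
the same pairing (sum_sign_susp).

The cone of a map f from C to D is an extension of the suspension of C by D, and
suspension reverses absolute torsion; this is the formula for contractible
complexes. Homotopic maps have cones that are isomorphic by elementary matrices.
For a morphism (a, b, c) of short exact sequences the cone of b is an extension of
the cone of c by that of a, and the two sign identities identify the torsion of
this extension with the difference of those of the two rows
(tauN_map_extension). Direct sums are a special case, and so is the last
property, for the sequence 0 -> X -> X -> 0 -> 0 mapping to the given one.

Composition is a special case as well. The map with matrix (f -1; 0 g) from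
C (+) D to D (+) E can be filtered with f and g on the graded pieces, or with
g f and -1. Comparison gives additivity up to the torsion of the identity of D
(tauN_map_comp_neg, tauN_map_neg). That torsion vanishes by induction on the
length of D, once more by additivity and suspension (tauN_id). *)

(** * Identities in abelian groups *)

(** Syntax trees for a reflexive decision procedure: two abelian group
expressions agree as soon as their atoms have the same integer coefficients.
Atoms are compared up to conversion, because the same element may occur under
different structure paths. *)
Inductive zexp := ZVar of nat | ZNil | ZAdd of zexp & zexp | ZOpp of zexp.

Fixpoint zeval (V : zmodType) (env : seq V) (e : zexp) : V :=
  match e with
  | ZVar i => nth 0 env i
  | ZNil => 0
  | ZAdd e1 e2 => zeval env e1 + zeval env e2
  | ZOpp e1 => - zeval env e1
  end.

Fixpoint zcoef (i : nat) (e : zexp) : int :=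
  match e with
  | ZVar j => Posz (i == j)
  | ZNil => 0
  | ZAdd e1 e2 => zcoef i e1 + zcoef i e2
  | ZOpp e1 => - zcoef i e1
  end.

Lemma zevalE (V : zmodType) (env : seq V) e :
  zeval env e = \sum_(i < size env) env`_i *~ zcoef i e.
Proof.
elim: e => [j||e1 IH1 e2 IH2|e IH] /=.
- have [h|h] := ltnP j (size env).
    rewrite (bigD1 (Ordinal h)) //= eqxx big1 ?addr0 // => i hi.
    by rewrite -[_ == _]/(i == Ordinal h) (negbTE hi).
  rewrite nth_default // big1 // => i _.
  by rewrite (ltn_eqF (leq_trans (ltn_ord i) h)).
- by rewrite big1.
- by rewrite IH1 IH2 -big_split; apply: eq_bigr => i _; rewrite mulrzDr.
- by rewrite IH -sumrN; apply: eq_bigr => i _; rewrite mulrNz.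
Qed.

Lemma zmodP (V : zmodType) (env : seq V) e1 e2 :
  all (fun i => zcoef i e1 == zcoef i e2) (iota 0 (size env)) ->
  zeval env e1 = zeval env e2.
Proof.
move=> /allP h; rewrite !zevalE; apply: eq_bigr => i _.
by rewrite (eqP (h i _)) // mem_iota /= ltn_ord.
Qed.

Ltac zmem x l := match l with
  | [::] => constr:(false)
  | ?y :: _ => let _ := constr:(erefl x : x = y) in constr:(true)
  | _ :: ?l' => zmem x l' end.
Ltac zindex x l := match l with
  | ?y :: _ => let _ := constr:(erefl x : x = y) in constr:(0%N)
  | _ :: ?l' => let i := zindex x l' in constr:(i.+1) end.
Ltac zatoms l t := lazymatch t with
  | ?a + ?b => let l' := zatoms l a in zatoms l' b
  | - ?a => zatoms l a
  | 0 => l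
  | _ => let b := zmem t l in
         lazymatch b with true => l | false => constr:(t :: l) end end.
Ltac zreify l t := lazymatch t with
  | ?a + ?b => let a' := zreify l a in let b' := zreify l b in constr:(ZAdd a' b')
  | - ?a => let a' := zreify l a in constr:(ZOpp a')
  | 0 => constr:(ZNil)
  | _ => let i := zindex t l in constr:(ZVar i) end.
Ltac zmodule := lazymatch goal with |- @eq ?T ?a ?b =>
  let l0 := zatoms (@nil T) a in let l := zatoms l0 b in
  let e1 := zreify l a in let e2 := zreify l b in
  exact (@zmodP _ l e1 e2 (erefl true)) end.

(** * Zero objects and elementary automorphisms *)

Section Objects.
Variable A : addCat.
Implicit Types W X Y Z : A.

Lemma is_zero_idm X : is_zero X -> idm X = 0.
Proof.
elim=> [|{}X Y _ hX _ hY]; first exact: idm_zob.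
by rewrite -mx22_1 hX hY mx22_0.
Qed.

Lemma zero_src X Y (f : hom X Y) : is_zero X -> f = 0.
Proof. by move=> hX; rewrite -[f]compm1 is_zero_idm // compm0. Qed.

Lemma zero_tgt X Y (f : hom X Y) : is_zero Y -> f = 0.
Proof. by move=> hY; rewrite -[f]comp1m is_zero_idm // comp0m. Qed.

Lemma is_iso_zero X Y (f : hom X Y) : is_zero X -> is_zero Y -> is_iso f.
Proof. by move=> hX hY; exists 0; rewrite compm0 comp0m !is_zero_idm. Qed.

Lemma is_iso_prj1 X Y : is_zero Y -> is_iso (prj1 : hom (X \(+) Y) X).
Proof.
move=> hY; exists inj1; rewrite prj1_inj1 -inj_prj; split=> //.
by rewrite [inj2]zero_src // comp0m addr0.
Qed.

(** The unit relations of K_1 give torsion 0 to the maps into zob; any other map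
between zero objects is compared with these by composition. *)
Lemma tau1_zero X Y (f : hom X Y) : is_zero X -> is_zero Y -> tau1 f = 0.
Proof.
have zz : is_zero (zob : A) by exact: is_zero_zob.
have u Z : is_zero Z -> tau1 (0 : hom Z zob) = 0.
  elim=> [|U V hU eU hV eV]; first by rewrite -idm_zob tau1_id.
  have -> : (0 : hom (U \(+) V) zob) = prj1 \oc msum (0 : hom U zob) (0 : hom V zob).
    by rewrite /msum mx22_0 compm0.
  rewrite tau1_comp ?tau1_sum ?eU ?eV; do ?[exact: is_iso_zero].
  - rewrite (tau1E (is_iso_prj1 _ zz)) !add0r.
    exact/ppi_rel/K1_unitr.
  - by apply: is_iso_msum; exact: is_iso_zero.
  - exact: is_iso_prj1.
move=> hX hY; have := @tau1_comp _ _ _ _ (0 : hom Y zob) f.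
by rewrite comp0m !u // addr0 => <- //; exact: is_iso_zero.
Qed.

Lemma tau1_prj1 X Y : is_zero Y -> tau1 (prj1 : hom (X \(+) Y) X) = 0.
Proof.
move=> hY; have zz : is_zero (zob : A) by exact: is_zero_zob.
have i0 : is_iso (0 : hom Y zob) by exact: is_iso_zero.
have -> : prj1 = prj1 \oc msum (idm X) (0 : hom Y zob).
  by rewrite /msum /mx22 /row2 !catE.
rewrite tau1_comp ?tau1_sum ?tau1_id ?(tau1_zero _ hY) //; last exact: is_iso_prj1.
- by rewrite (tau1E (is_iso_prj1 _ zz)) !add0r; exact/ppi_rel/K1_unitr.
- exact: is_iso_id.
- by apply: is_iso_msum => //; exact: is_iso_id.
Qed.

(** A zero object X is isomorphic to X \(+) X, so that eps X Y is equal to its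
double. *)
Lemma eps_zerol X Y : is_zero X -> eps X Y = 0.
Proof.
move=> hX; have e : isomorphic X (X \(+) X).
  by exists 0; apply: is_iso_zero => //; exact: is_zero_osum.
by have := eps_iso e (isomorphic_refl Y); rewrite epsDl -[LHS]addr0 => /addrI <-.
Qed.

Lemma eps_zeror X Y : is_zero Y -> eps X Y = 0.
Proof. by move=> hY; rewrite epsC eps_zerol // oppr0. Qed.

(** Whitehead's argument, with summands that need not be isomorphic: on (X \(+)
Y) \(+) Y let P be the elementary automorphism E extended by 1, let Q add the
last summand to the second one, and let R be the elementary automorphism with
entry e from the last summand to X. Then P Q = R Q P, so that R has torsion 0,
and R is conjugate to P by the exchange of the two copies of Y. *)
Lemma tau1_upper X Y (e : hom Y X) : tau1 (mx22 (idm X) e 0 (idm Y)) = 0.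
Proof.
set E := mx22 _ _ _ _.
have uV Z T (x : hom Z T) : is_iso (mx22 (idm T) x 0 (idm Z)).
  exists (mx22 (idm T) (- x) 0 (idm Z)).
  by rewrite !mx22M !catE addNr subrr mx22_1.
have iE : is_iso E by exact: uV.
pose P := msum E (idm Y).
pose Q := mx22 (idm (X \(+) Y)) inj2 0 (idm Y).
pose R := mx22 (idm (X \(+) Y)) (inj1 \oc e) 0 (idm Y).
pose S : hom ((X \(+) Y) \(+) Y) ((X \(+) Y) \(+) Y) :=
  mx22 (inj1 \oc prj1) inj2 prj2 0.
have iQ : is_iso Q by exact: uV.
have iR : is_iso R by exact: uV.
have iP : is_iso P by apply: is_iso_msum => //; exact: is_iso_id.
have iS : is_iso S.
  by exists S; rewrite /S !mx22M !catE inj_prj mx22_1.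
have eR : P \oc Q = R \oc (Q \oc P).
  by rewrite /P /Q /R /msum !mx22M !catE [inj2 + _]addrC.
have eS : S \oc P = R \oc S.
  by rewrite /S /P /R /E /msum !mx22M /mx22 /row2 !catE -?compA ?injprjE ?catE.
have tR : tau1 R = 0.
  have := congr1 (@tau1 _ _ _) eR.
  rewrite (tau1_comp iQ iP) (tau1_comp (is_iso_comp iQ iP) iR) (tau1_comp iP iQ).
  by rewrite addrC -[LHS]addr0 => /addrI <-.
have tP : tau1 P = tau1 R.
  have := congr1 (@tau1 _ _ _) eS.
  by rewrite (tau1_comp iP iS) (tau1_comp iS iR) addrC => /addrI.
by move: tP; rewrite tR tau1_sum ?tau1_id ?addr0 //; exact: is_iso_id.
Qed.

End Objects.

(** * Matrices between iterated direct sums *)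

Section Matrices.
Variable A : addCat.
Implicit Types (X Y Z T : A) (F G H : nat -> A).

Lemma tau1_lower X Y (e : hom X Y) : tau1 (mx22 (idm X) 0 e (idm Y)) = 0.
Proof.
have -> : mx22 (idm X) 0 e (idm Y) =
    swap Y X \oc (mx22 (idm Y) e 0 (idm X) \oc swap X Y).
  by rewrite /swap !mx22M !catE.
have iU : is_iso (mx22 (idm Y) e 0 (idm X)).
  exists (mx22 (idm Y) (- e) 0 (idm X)).
  by rewrite !mx22M !catE addNr subrr mx22_1.
have iS := is_iso_swap; rewrite tau1_comp //; last exact: is_iso_comp.
by rewrite tau1_comp // tau1_upper addr0 -!/(eps _ _) [eps Y X]epsC subrr.
Qed.

Lemma mx22D X Y X' Y' (a a' : hom X X') (b b' : hom Y X') (c c' : hom X Y')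
    (d d' : hom Y Y') :
  mx22 a b c d + mx22 a' b' c' d' = mx22 (a + a') (b + b') (c + c') (d + d').
Proof.
apply: sum_ext; rewrite compDl ?mx22_inj1 ?mx22_inj2 !compDr; exact: addrACA.
Qed.

Definition mid4 X Y Z T : hom ((X \(+) Y) \(+) (Z \(+) T)) ((X \(+) Z) \(+) (Y \(+) T)) :=
  row2 (msum inj1 inj1) (msum inj2 inj2).

Lemma mid4K X Y Z T : mid4 X Z Y T \oc mid4 X Y Z T = idm _.
Proof.
by apply: sum_ext; apply: sum_ext; apply: sum_coext; apply: sum_coext;
  rewrite /mid4 /msum /mx22 /row2 !catE.
Qed.

Lemma is_iso_mid4 X Y Z T : is_iso (mid4 X Y Z T).
Proof. by exists (mid4 X Z Y T); rewrite !mid4K. Qed.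

(** Up to associativity isomorphisms, which have torsion 0, only Y and Z are
exchanged. *)
Lemma tau1_mid4 X Y Z T : tau1 (mid4 X Y Z T) = eps Y Z.
Proof.
pose a1 := assoc X Y (Z \(+) T).
pose a2 := msum (idm X) (assocV Y Z T).
pose a3 := msum (idm X) (msum (swap Y Z) (idm T)).
pose a4 := msum (idm X) (assoc Z Y T).
pose a5 := assocV X Z (Y \(+) T).
have -> : mid4 X Y Z T = a5 \oc (a4 \oc (a3 \oc (a2 \oc a1))).
  have m4 : [/\ mid4 X Y Z T \oc inj1 = msum inj1 inj1
               & mid4 X Y Z T \oc inj2 = msum inj2 inj2].
    by rewrite /mid4 /row2 !catE.
  case: m4 => m41 m42.
  apply: sum_ext; [rewrite m41|rewrite m42]; apply: sum_ext;
    rewrite ?msum_inj1 ?msum_inj2 -!compA.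
  - rewrite (compA a1) assoc_inj11 /a2 msum_inj1 compm1 /a3 msum_inj1 compm1.
    by rewrite /a4 msum_inj1 compm1 /a5 assocV_inj1.
  - rewrite (compA a1) assoc_inj12 /a2 (compA (msum _ _)) msum_inj2 -compA.
    rewrite assocV_inj1 /a3 (compA (msum _ _)) msum_inj2 -compA (compA (msum _ _)).
    rewrite msum_inj1 -compA swap_inj1 /a4 (compA (msum _ _)) msum_inj2 -compA.
    by rewrite (compA (assoc _ _ _)) assoc_inj12 /a5 !compA assocV_inj22.
  - rewrite (compA a1) assoc_inj2 /a2 -compA (compA (msum _ _)) msum_inj2 -compA.
    rewrite (compA (assocV _ _ _)) assocV_inj21.
    rewrite /a3 (compA (msum _ _)) msum_inj2 -compA (compA (msum _ _)).
    rewrite msum_inj1 -compA swap_inj2 /a4 (compA (msum _ _)) msum_inj2 -compA.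
    by rewrite (compA (assoc _ _ _)) assoc_inj11 /a5 !compA assocV_inj21.
  - rewrite (compA a1) assoc_inj2 /a2 -compA (compA (msum _ _)) msum_inj2 -compA.
    rewrite (compA (assocV _ _ _)) assocV_inj22.
    rewrite /a3 (compA (msum _ _)) msum_inj2 -compA.
    rewrite msum_inj2 compm1 /a4 (compA (msum _ _)) msum_inj2 -compA.
    by rewrite assoc_inj2 /a5 !compA assocV_inj22.
have i1 : is_iso a1 by exact: is_iso_assoc.
have iX := is_iso_id X; have iT := is_iso_id T.
have i2 : is_iso a2 by apply: is_iso_msum (is_iso_assocV _ _ _).
have i3' := is_iso_msum (is_iso_swap Y Z) iT.
have i3 : is_iso a3 by apply: is_iso_msum i3'.
have i4 : is_iso a4 by apply: is_iso_msum (is_iso_assoc _ _ _).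
have i5 : is_iso a5 by exact: is_iso_assocV.
have i21 := is_iso_comp i2 i1; have i321 := is_iso_comp i3 i21.
rewrite (tau1_comp (is_iso_comp i4 i321) i5) (tau1_comp i321 i4) (tau1_comp i21 i3).
rewrite (tau1_comp i1 i2) (tau1_sum iX (is_iso_assocV _ _ _)) (tau1_sum iX i3').
rewrite (tau1_sum iX (is_iso_assoc _ _ _)) (tau1_sum (is_iso_swap Y Z) iT).
by rewrite !tau1_assoc !tau1_assocV !tau1_id !addr0 !add0r.
Qed.

Lemma eq_dcol F X (v w : forall i, hom X (F i)) n :
  (forall i, (i < n)%N -> v i = w i) -> dcol v n = dcol w n.
Proof.
elim: n => //= n IH e; rewrite e // IH // => i h; apply: e; exact: ltnW.
Qed.

Lemma eq_drow F Y (v w : forall j, hom (F j) Y) n :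
  (forall j, (j < n)%N -> v j = w j) -> drow v n = drow w n.
Proof.
elim: n => //= n IH e; rewrite e // IH // => i h; apply: e; exact: ltnW.
Qed.

Lemma dcol0 F X (v : forall i, hom X (F i)) n :
  (forall i, (i < n)%N -> v i = 0) -> dcol v n = 0.
Proof.
elim: n => //= n IH e; rewrite e // IH ?compm0 ?addr0 // => i h.
by apply: e; exact: ltnW.
Qed.

Lemma drow0 F Y (u : forall j, hom (F j) Y) n :
  (forall j, (j < n)%N -> u j = 0) -> drow u n = 0.
Proof.
elim: n => //= n IH e; rewrite e // IH /row2 ?comp0m ?addr0 // => i h.
by apply: e; exact: ltnW.
Qed.

Lemma dcol_comp F X Y (v : forall i, hom X (F i)) (f : hom Y X) n :
  dcol v n \oc f = dcol (fun i => v i \oc f) n.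
Proof. by elim: n => [|n IH] /=; rewrite ?comp0m // compDl -!compA IH. Qed.

Lemma comp_drow F X Y (u : forall j, hom (F j) X) (f : hom X Y) n :
  f \oc drow u n = drow (fun j => f \oc u j) n.
Proof. by elim: n => [|n IH] /=; rewrite ?compm0 // compDr !compA IH. Qed.

Lemma drow_dcol F X Y (u : forall j, hom (F j) Y) (v : forall i, hom X (F i)) n :
  drow u n \oc dcol v n = \sum_(k < n) u k \oc v k.
Proof.
elim: n => [|n IH] /=; first by rewrite big_ord0 comp0m.
by rewrite big_ord_recr /= -IH /row2 !catE.
Qed.

Lemma dcol_add F X (v w : forall i, hom X (F i)) n :
  dcol v n + dcol w n = dcol (fun i => v i + w i) n.
Proof. by elim: n => [|n IH] /=; rewrite ?addr0 // addrACA -!compDr IH. Qed.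

Lemma drow_add F Y (v w : forall j, hom (F j) Y) n :
  drow v n + drow w n = drow (fun j => v j + w j) n.
Proof.
by elim: n => [|n IH] /=; rewrite ?addr0 // /row2 addrACA -!compDl IH.
Qed.

Lemma dcol_drow F G (m : forall i j, hom (F j) (G i)) n p :
  drow (fun j => dcol (fun i => m i j) n) p = dcol (fun i => drow (m i) p) n.
Proof.
elim: p => [|p IH] /=; last first.
  by rewrite IH /row2 !dcol_comp dcol_add.
by elim: n => //= n <-; rewrite !compm0 addr0.
Qed.

Lemma eq_dmx F G (m m' : forall i j, hom (F j) (G i)) n :
  (forall i j, (i < n)%N -> (j < n)%N -> m i j = m' i j) -> dmx m n = dmx m' n.
Proof. by move=> e; apply: eq_drow => j hj; apply: eq_dcol => i hi; exact: e. Qed.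

Lemma dmx_mul F G H (m : forall i j, hom (G j) (H i)) (m' : forall i j, hom (F j) (G i)) n :
  dmx m n \oc dmx m' n = dmx (fun i j => \sum_(k < n) m i k \oc m' k j) n.
Proof.
rewrite {2}/dmx comp_drow; apply: eq_drow => j _.
by rewrite /dmx dcol_drow dcol_comp; apply: eq_dcol => i _; rewrite drow_dcol.
Qed.

Lemma dmx_add F G (m m' : forall i j, hom (F j) (G i)) n :
  dmx m n + dmx m' n = dmx (fun i j => m i j + m' i j) n.
Proof.
by rewrite /dmx drow_add; apply: eq_drow => j _; rewrite dcol_add.
Qed.

Lemma dmx_opp F G (m : forall i j, hom (F j) (G i)) n :
  - dmx m n = dmx (fun i j => - m i j) n.
Proof.
apply: (addrI (dmx m n)); rewrite subrr dmx_add; symmetry.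
transitivity (dmx (fun i j => 0 : hom (F j) (G i)) n).
  by apply: eq_dmx => i j _ _; rewrite subrr.
apply: (addrI (dmx (fun i j => 0 : hom (F j) (G i)) n)); rewrite dmx_add addr0.
by apply: eq_dmx => i j _ _; rewrite addr0.
Qed.

Lemma dmxS F G (m : forall i j, hom (F j) (G i)) n :
  dmx m n.+1 = mx22 (dmx m n) (dcol (fun i => m i n) n) (drow (m n) n) (m n n).
Proof.
apply: sum_ext; rewrite ?mx22_inj1 ?mx22_inj2 /dmx /= /row2 !catE //.
by rewrite !comp_drow drow_add.
Qed.

Fixpoint dmap F G (phi : forall i, hom (F i) (G i)) n : hom (dsum F n) (dsum G n) :=
  if n is n'.+1 then msum (dmap phi n') (phi n') else idm zob.

Lemma is_iso_dmap F G (phi : forall i, hom (F i) (G i)) n :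
  (forall i, (i < n)%N -> is_iso (phi i)) -> is_iso (dmap phi n).
Proof.
elim: n => [|n IH] h; first exact: is_iso_id.
by apply: is_iso_msum; [apply: IH => i hi; apply: h; exact: ltnW | exact: h].
Qed.

Lemma tau1_dmap F G (phi : forall i, hom (F i) (G i)) n :
  (forall i, (i < n)%N -> is_iso (phi i)) ->
  tau1 (dmap phi n) = \sum_(i < n) tau1 (phi i).
Proof.
elim: n => [|n IH] h; first by rewrite big_ord0 tau1_id.
rewrite big_ord_recr -IH /=; last by move=> i hi; apply: h; exact: ltnW.
apply: tau1_sum; last exact: h.
by apply: is_iso_dmap => i hi; apply: h; exact: ltnW.
Qed.

Lemma dmap_dcol F G X (phi : forall i, hom (F i) (G i)) (v : forall i, hom X (F i)) n :
  dmap phi n \oc dcol v n = dcol (fun i => phi i \oc v i) n.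
Proof.
elim: n => [|n IH] /=; first by rewrite compm0.
by rewrite compDr !compA msum_inj1 msum_inj2 -!compA IH.
Qed.

Lemma drow_dmap F G Y (phi : forall i, hom (F i) (G i)) (u : forall j, hom (G j) Y) n :
  drow u n \oc dmap phi n = drow (fun j => u j \oc phi j) n.
Proof.
elim: n => [|n IH] /=; first by rewrite comp0m.
by apply: sum_ext; rewrite -compA ?msum_inj1 ?msum_inj2 /row2 !catE ?IH.
Qed.

Lemma dmap_dmx F G H (phi : forall i, hom (G i) (H i)) (m : forall i j, hom (F j) (G i)) n :
  dmap phi n \oc dmx m n = dmx (fun i j => phi i \oc m i j) n.
Proof. by rewrite /dmx comp_drow; apply: eq_drow => j _; rewrite dmap_dcol. Qed.

Lemma dmx_dmap F G H (phi : forall i, hom (F i) (G i)) (m : forall i j, hom (G j) (H i)) n :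
  dmx m n \oc dmap phi n = dmx (fun i j => m i j \oc phi j) n.
Proof. by rewrite /dmx drow_dmap; apply: eq_drow => j _; rewrite dcol_comp. Qed.

End Matrices.

(** * Triangular matrices and independence of the contraction *)

Section Triangular.
Variable A : addCat.
Implicit Types (X Y Z T : A) (F G H : nat -> A).

(** At least k block diagonals below the main one; these degrees add up under
composition. The matrix is existentially quantified since its entries outside of
the range of summation are not determined by the morphism. *)
Definition lower F G n k (x : hom (dsum F n) (dsum G n)) : Prop :=
  exists m, x = dmx m n /\ forall i j, (i < j + k)%N -> m i j = 0.

Lemma lower_comp F G H n k l (x : hom (dsum G n) (dsum H n)) (y : hom (dsum F n) (dsum G n)) :
  lower k x -> lower l y -> lower (k + l) (x \oc y).
Proof.
case=> m [-> hm] [m' [-> hm']]; rewrite dmx_mul; eexists; split; first by [].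
move=> i j hij /=; rewrite big1 // => p _.
have [h|h] := ltnP i (p + k); first by rewrite hm ?comp0m.
by rewrite hm' ?compm0 //; lia.
Qed.

Lemma lower_add F G n k (x y : hom (dsum F n) (dsum G n)) :
  lower k x -> lower k y -> lower k (x + y).
Proof.
case=> m [-> hm] [m' [-> hm']]; rewrite dmx_add; eexists; split; first by [].
by move=> i j h /=; rewrite hm // hm' // addr0.
Qed.

Lemma lower_opp F G n k (x : hom (dsum F n) (dsum G n)) : lower k x -> lower k (- x).
Proof.
case=> m [-> hm]; rewrite dmx_opp; eexists; split; first by [].
by move=> i j h /=; rewrite hm // oppr0.
Qed.

Lemma lower_weak F G n k l (x : hom (dsum F n) (dsum G n)) :
  (l <= k)%N -> lower k x -> lower l x.
Proof.
move=> hl [m [-> hm]]; exists m; split=> // i j h; apply: hm.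
by rewrite (leq_trans h) // leq_add2l.
Qed.

(** Splitting off the last summand writes 1 + x as the product of an elementary
automorphism and a smaller unipotent matrix. *)
Lemma unipotent_iso_tau F n (x : hom (dsum F n) (dsum F n)) :
  lower 1 x -> is_iso (idm _ + x) /\ tau1 (idm _ + x) = 0.
Proof.
case=> m [-> hm]; elim: n {x} => [|n [iu tu]].
  split; [exact: is_iso_zero (is_zero_zob A) (is_zero_zob A)|].
  exact: tau1_zero (is_zero_zob A) (is_zero_zob A).
have -> : idm _ + dmx m n.+1 = msum (idm _ + dmx m n) (idm (F n)) \oc
    mx22 (idm _) 0 (drow (m n) n) (idm (F n)).
  have -> : dmx m n.+1 = mx22 (dmx m n) 0 (drow (m n) n) 0.
    rewrite dmxS hm ?addn1 //; congr mx22.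
    by apply: dcol0 => i hi; rewrite hm ?addn1 // ltnW.
  rewrite /msum mx22M !catE -[in LHS]mx22_1 /mx22 /row2 !catE.
  by apply: sum_ext; apply: sum_coext; rewrite !catE ?(addrC (dmx m n)).
have il : is_iso (mx22 (idm (dsum F n)) 0 (drow (m n) n) (idm (F n))).
  exists (mx22 (idm _) 0 (- drow (m n) n) (idm _)).
  by rewrite !mx22M !catE addNr subrr mx22_1.
have i1 := is_iso_id (F n); have ium := is_iso_msum iu i1.
by split; [exact: is_iso_comp|rewrite tau1_comp // tau1_lower tau1_sum // tu tau1_id !addr0].
Qed.

Lemma is_iso_2sided X Y Z T (f : hom X Y) (g : hom Y Z) (h : hom T X) :
  is_iso (g \oc f) -> is_iso (f \oc h) -> is_iso f.
Proof.
case=> u [u1 _] [v [_ v2]]; rewrite compA in u1; rewrite -compA in v2.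
suff e : u \oc g = h \oc v by exists (u \oc g); split=> //; rewrite e.
by rewrite -[LHS]compm1 -v2 compA u1 comp1m.
Qed.

Lemma dmx_id F (m : forall i j, hom (F j) (F i)) n :
  (forall i, (i < n)%N -> m i i = idm (F i)) ->
  (forall i j, i != j -> m i j = 0) -> dmx m n = idm (dsum F n).
Proof.
move=> h1 h0; elim: n h1 => [|n IH] h1; first by rewrite /= is_zero_idm //; exact: is_zero_zob.
rewrite dmxS IH => [|i hi]; last by apply: h1; exact: ltnW.
rewrite h1 // -mx22_1; congr mx22.
  by apply: dcol0 => i hi; rewrite h0 ?ltn_eqF.
by apply: drow0 => i hi; rewrite h0 ?gtn_eqF.
Qed.

Lemma sum_one_term (V : zmodType) n (f : nat -> V) k0 :
  (forall k, k != k0 -> f k = 0) ->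
  \sum_(k < n) f k = if (k0 < n)%N then f k0 else 0.
Proof.
move=> h; case: ifP => hk.
  rewrite (bigD1 (Ordinal hk)) //= big1 ?addr0 // => k hk'.
  by apply: h; apply: contraNneq hk' => e; apply/eqP/val_inj.
by rewrite big1 // => k _; apply: h; apply: contraFneq hk => <-.
Qed.

Section Entries.
Variables (C : complex A) (G : forall r, hom (C r) (C r.+1)).

Lemma d_atE s : d_at C s.+1 s = cd C s.
Proof.
rewrite /d_at; case: eqP => // e.
by rewrite (eq_irrelevance e erefl) /= compm1.
Qed.

Lemma d_at0 r s : r != s.+1 -> d_at C r s = 0.
Proof. by rewrite /d_at; case: eqP. Qed.

Lemma up_atE r : up_at G r r.+1 = G r.
Proof.
rewrite /up_at; case: eqP => // e.
by rewrite (eq_irrelevance e erefl) /= comp1m.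
Qed.

Lemma up_at0 r s : r.+1 != s -> up_at G r s = 0.
Proof. by rewrite /up_at; case: eqP. Qed.

Lemma d_at_d_at r s t : d_at C s r \oc d_at C t s = 0.
Proof.
have [->|h] := eqVneq s r.+1; last by rewrite (d_at0 h) comp0m.
have [->|h] := eqVneq t r.+2; last by rewrite (d_at0 h) compm0.
by rewrite !d_atE cdd.
Qed.

Variable n : nat.

(** The letters are those of matrix entries: EO has rows of even degree and
columns of odd degree, so that it maps the odd part to the even part. These are
the components of d, and below those of a map u of degree 1, on the n lowest
degrees of each parity. *)
Definition dEO : hom (dsum (fun j => C j.*2.+1) n) (dsum (fun i => C i.*2) n) :=
  dmx (fun i j => d_at C j.*2.+1 i.*2) n.
Definition dOE : hom (dsum (fun j => C j.*2) n) (dsum (fun i => C i.*2.+1) n) :=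
  dmx (fun i j => d_at C j.*2 i.*2.+1) n.
Definition uEO : hom (dsum (fun j => C j.*2.+1) n) (dsum (fun i => C i.*2) n) :=
  dmx (fun i j => up_at G j.*2.+1 i.*2) n.
Definition uOE : hom (dsum (fun j => C j.*2) n) (dsum (fun i => C i.*2.+1) n) :=
  dmx (fun i j => up_at G j.*2 i.*2.+1) n.

Lemma dEO_dOE : dEO \oc dOE = 0.
Proof.
rewrite dmx_mul; apply: (addrI (dEO \oc dOE)); rewrite addr0 dmx_mul dmx_add.
by apply: eq_dmx => i j _ _; rewrite !big1 ?addr0 // => k _; exact: d_at_d_at.
Qed.

Lemma dOE_dEO : dOE \oc dEO = 0.
Proof.
rewrite dmx_mul; apply: (addrI (dOE \oc dEO)); rewrite addr0 dmx_mul dmx_add.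
by apply: eq_dmx => i j _ _; rewrite !big1 ?addr0 // => k _; exact: d_at_d_at.
Qed.

Lemma lower_dEO : lower 0 dEO.
Proof.
by eexists; split=> [|i j h]; [reflexivity|rewrite /= d_at0 //; apply/eqP; lia].
Qed.

Lemma lower_uEO : lower 1 uEO.
Proof.
by eexists; split=> [|i j h]; [reflexivity|rewrite /= up_at0 //; apply/eqP; lia].
Qed.

Lemma lower_uOE : lower 0 uOE.
Proof.
by eexists; split=> [|i j h]; [reflexivity|rewrite /= up_at0 //; apply/eqP; lia].
Qed.

Hypotheses (hG : contraction G) (hn : (clen C <= n)%N).

Lemma contraction_even : dEO \oc uOE + uEO \oc dOE = idm _.
Proof.
rewrite !dmx_mul dmx_add; apply: dmx_id => [i hi|i j hij].
  rewrite (@sum_one_term _ n (fun k => d_at C k.*2.+1 i.*2 \oc up_at G i.*2 k.*2.+1) i);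
    last by move=> k hk; rewrite d_at0 ?comp0m //; apply/eqP; lia.
  rewrite hi d_atE up_atE; case: i hi => [|i] hi.
    rewrite big1 ?addr0 ?(proj1 hG) // => k _.
    by rewrite d_at0 ?compm0.
  rewrite (@sum_one_term _ n (fun k => up_at G k.*2.+1 i.+1.*2 \oc d_at C i.+1.*2 k.*2.+1) i);
    last by move=> k hk; rewrite d_at0 ?compm0 //; apply/eqP; lia.
  by rewrite (ltnW hi) d_atE up_atE; exact: (proj2 hG).
rewrite [X in X + _]big1 ?[X in _ + X]big1 ?addr0 // => k _.
  have [e|h] := eqVneq (k.+1 : nat) i.
    by rewrite [d_at _ _ _]d_at0 ?compm0 //; apply/eqP; lia.
  by rewrite up_at0 ?comp0m //; apply/eqP; lia.
have [e|h] := eqVneq (k : nat) i.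
  by rewrite up_at0 ?compm0 //; apply/eqP; lia.
by rewrite d_at0 ?comp0m //; apply/eqP; lia.
Qed.

Lemma contraction_odd : dOE \oc uEO + uOE \oc dEO = idm _.
Proof.
rewrite !dmx_mul dmx_add; apply: dmx_id => [i hi|i j hij].
  rewrite (@sum_one_term _ n (fun k => d_at C k.*2 i.*2.+1 \oc up_at G i.*2.+1 k.*2) i.+1);
    last by move=> k hk; rewrite d_at0 ?comp0m //; apply/eqP; lia.
  rewrite (@sum_one_term _ n (fun k => up_at G k.*2 i.*2.+1 \oc d_at C i.*2.+1 k.*2) i);
    last by move=> k hk; rewrite d_at0 ?compm0 //; apply/eqP; lia.
  (* For i = n.-1 the missing summand passes through the zero object C n.*2. *)
  rewrite hi -(proj2 hG i.*2) d_atE up_atE; case: ifP => h.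
    by rewrite (d_atE i.*2.+1) (up_atE i.*2.+1).
  rewrite [G i.*2.+1]zero_tgt ?compm0 //; apply: (@cfin _ C); lia.
rewrite [X in X + _]big1 ?[X in _ + X]big1 ?addr0 // => k _.
  have [e|h] := eqVneq (k : nat) i.
    by rewrite [d_at _ _ _]d_at0 ?compm0 //; apply/eqP; lia.
  by rewrite up_at0 ?comp0m //; apply/eqP; lia.
have [e|h] := eqVneq (k : nat) i.+1.
  by rewrite up_at0 ?compm0 //; apply/eqP; lia.
by rewrite d_at0 ?comp0m //; apply/eqP; lia.
Qed.

End Entries.

Section Independence.
Variables (C : complex A) (n : nat).
Hypothesis hn : (clen C <= n)%N.

Definition dplusEO (G : forall r, hom (C r) (C r.+1)) := dEO C n + uEO G n.
Definition dplusOE (G : forall r, hom (C r) (C r.+1)) := dOE C n + uOE G n.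

(** Independence of the contraction rests on this product. For D = d + G and D'
= d + G' the product D' D is not unipotent, its diagonal part being d G + G' d;
but D' (1 + G' G) D is 1 plus terms that raise the degree by at least 2. So D'
on the even part and D on the odd part have opposite torsions, whichever
contractions are used. *)
Lemma dplusOE_dplusEO (G G' : forall r, hom (C r) (C r.+1)) : contraction G -> contraction G' ->
  let w := idm _ + uEO G' n \oc uOE G n in
  [/\ is_iso w, tau1 w = 0 & let v := dplusOE G' \oc w \oc dplusEO G in
      is_iso v /\ tau1 v = 0].
Proof.
move=> hG hG' w.
have [iw tw] : is_iso w /\ tau1 w = 0.
  by apply: unipotent_iso_tau; apply: (lower_comp (lower_uEO _ _) (lower_uOE _ _)).
split=> //=; set P := dEO C n; set Q := dOE C n.
set a := uEO G n; set b := uOE G n; set a' := uEO G' n; set b' := uOE G' n.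
have PQ : P \oc Q = 0 by exact: dEO_dOE.
have QP : Q \oc P = 0 by exact: dOE_dEO.
have Qa' : Q \oc a' = idm _ - b' \oc P.
  by rewrite -(contraction_odd hG' hn) addrK.
have Qa : Q \oc a = idm _ - b \oc P.
  by rewrite -(contraction_odd hG hn) addrK.
have Pb : P \oc b = idm _ - a \oc Q.
  by rewrite -(contraction_even hG hn) addrK.
have ew : w = idm _ + a' \oc b by [].
have e1 : (Q + b') \oc w = Q + b + b' \oc a \oc Q + b' \oc a' \oc b.
  rewrite ew compDr compm1 compDl !compA Qa' compDl compNm comp1m.
  rewrite -(compA b' P) Pb compDr compmN compm1 compA.
  zmodule.
pose v := dplusOE G' \oc w \oc dplusEO G; rewrite -/v.
have e2 : v = idm _ + (b \oc a + (b' \oc a + (- (b' \oc a \oc b \oc P) +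
    (b' \oc a' \oc b \oc P + b' \oc a' \oc b \oc a)))).
  rewrite /v /dplusOE -/Q -/b' e1 /dplusEO -/P -/a !compDl !compDr -!(compA _ Q) QP Qa.
  rewrite compm0 !compDr compmN compm1 !compA.
  zmodule.
rewrite e2; apply: unipotent_iso_tau.
have la : lower 1 a by exact: lower_uEO.
have la' : lower 1 a' by exact: lower_uEO.
have lb : lower 0 b by exact: lower_uOE.
have lb' : lower 0 b' by exact: lower_uOE.
have lP : lower 0 P by exact: lower_dEO.
have lb'a := lower_comp lb' la; have lb'a' := lower_comp lb' la'.
have lb'a'b := lower_comp lb'a' lb.
do ![apply: lower_add | apply: lower_opp].
- exact: (lower_comp lb la).
- exact: lb'a.
- exact: (lower_comp (lower_comp lb'a lb) lP).
- exact: (lower_comp lb'a'b lP).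
- by apply: (lower_weak _ (lower_comp lb'a'b la)).
Qed.

Lemma dplusEO_dplusOE (G : forall r, hom (C r) (C r.+1)) : contraction G ->
  is_iso (dplusEO G \oc dplusOE G).
Proof.
move=> hG; have -> : dplusEO G \oc dplusOE G = idm _ + uEO G n \oc uOE G n.
  rewrite /dplusEO /dplusOE compDl !compDr dEO_dOE add0r addrA; congr (_ + _).
  exact: contraction_even.
have [//] := unipotent_iso_tau (lower_comp (lower_uEO G n) (lower_uOE G n)).
Qed.

Lemma is_iso_dplusEO (G : forall r, hom (C r) (C r.+1)) : contraction G -> is_iso (dplusEO G).
Proof.
move=> hG; have [iw _ [iv _]] := dplusOE_dplusEO hG hG.
have i := dplusEO_dplusOE hG.
exact: is_iso_2sided iv i.
Qed.

Lemma is_iso_dplusOE (G : forall r, hom (C r) (C r.+1)) : contraction G -> is_iso (dplusOE G).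
Proof.
move=> hG; have [iw _ [iv _]] := dplusOE_dplusEO hG hG.
have i := dplusEO_dplusOE hG; have := is_iso_dplusEO hG.
case=> g [g1 g2].
suff -> : dplusOE G = g \oc (dplusEO G \oc dplusOE G).
  by apply: is_iso_comp => //; exists (dplusEO G).
by rewrite compA g1 comp1m.
Qed.

Lemma tau1_dplusOE (G G' : forall r, hom (C r) (C r.+1)) : contraction G -> contraction G' ->
  tau1 (dplusOE G') = - tau1 (dplusEO G).
Proof.
move=> hG hG'; have [iw tw [iv tv]] := dplusOE_dplusEO hG hG'.
apply/eqP; rewrite -addr_eq0; apply/eqP; rewrite -[RHS]tv.
have io := is_iso_dplusOE hG'.
rewrite (tau1_comp (is_iso_dplusEO hG) (is_iso_comp io iw)) (tau1_comp iw io).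
by rewrite tw add0r addrC.
Qed.

Lemma tau1_dplusEO (G G' : forall r, hom (C r) (C r.+1)) : contraction G -> contraction G' ->
  tau1 (dplusEO G) = tau1 (dplusEO G').
Proof.
move=> hG hG'; apply: oppr_inj.
by rewrite -(tau1_dplusOE hG hG) (tau1_dplusOE hG' hG).
Qed.

End Independence.
End Triangular.

(** * Alternating sums *)

Section AlternatingSums.
Variable V : zmodType.
Implicit Types f g : nat -> V.

Definition altsum f n := \sum_(r < n) f r *~ (-1) ^+ r.

Lemma altsum_double f n :
  altsum f n.*2 = \sum_(i < n) f i.*2 - \sum_(i < n) f i.*2.+1.
Proof.
rewrite /altsum; elim: n => [|n IH]; first by rewrite !big_ord0 subrr.
rewrite doubleS !big_ord_recr /= IH -signr_odd odd_double mulr1z.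
by rewrite exprS mulN1r -signr_odd odd_double mulrNz mulr1z; zmodule.
Qed.

Lemma altsum_stable f m n : (forall r, (m <= r)%N -> f r = 0) -> (m <= n)%N ->
  altsum f n = altsum f m.
Proof.
move=> h; elim: n => [|n IH]; first by case: m h.
rewrite leq_eqVlt => /predU1P[-> //|]; rewrite ltnS => hmn.
by rewrite /altsum big_ord_recr /= -/(altsum f n) IH // h // mul0rz addr0.
Qed.

Lemma altsum_shift f n : f 0%N = 0 -> altsum f n.+1 = - altsum (fun r => f r.+1) n.
Proof.
move=> h; rewrite /altsum big_ord_recl h mul0rz add0r -sumrN.
by apply: eq_bigr => i _; rewrite exprS mulN1r mulrNz.
Qed.

Lemma altsumD f g n : altsum (fun r => f r + g r) n = altsum f n + altsum g n.
Proof. by rewrite /altsum -big_split; apply: eq_bigr => i _; rewrite mulrzDl. Qed.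

Lemma eq_altsum f g n : (forall r, f r = g r) -> altsum f n = altsum g n.
Proof. by move=> h; apply: eq_bigr => i _; rewrite h. Qed.

End AlternatingSums.

(** * Torsion of isomorphic complexes, direct sums and suspensions *)

Section Torsion.
Variable A : addCat.
Implicit Types (X Y Z T : A) (C D : complex A).

Lemma dplusEOE C (G : forall r, hom (C r) (C r.+1)) n : dplusEO n G =
  dmx (fun i j => d_at C j.*2.+1 i.*2 + up_at G j.*2.+1 i.*2) n.
Proof. exact: dmx_add. Qed.

Lemma dplusOEE C (G : forall r, hom (C r) (C r.+1)) n : dplusOE n G =
  dmx (fun i j => d_at C j.*2 i.*2.+1 + up_at G j.*2 i.*2.+1) n.
Proof. exact: dmx_add. Qed.

(** Beyond the length of the complex a larger bound only adds summands that are
zero objects. *)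
Lemma tauE C (G : forall r, hom (C r) (C r.+1)) n :
  contraction G -> (clen C <= n)%N -> tau C = tau1 (dplusEO n G).
Proof.
move=> hG; elim: n => [|n IH]; rewrite leq_eqVlt => /predU1P[e|]; rewrite ?ltn0 //.
- rewrite -e /tau; case: pselect => [h|]; last by case; exists G.
  rewrite /d_plus -dplusEOE; apply: tau1_dplusEO => //; exact: projT2 (cid h).
- rewrite -e /tau; case: pselect => [h|]; last by case; exists G.
  rewrite /d_plus -dplusEOE; apply: tau1_dplusEO => //; exact: projT2 (cid h).
rewrite ltnS => hn; rewrite IH //.
have z1 : is_zero (C n.*2.+1) by apply: (@cfin _ C); lia.
have z0 : is_zero (C n.*2) by apply: (@cfin _ C); lia.
rewrite [in RHS]dplusEOE dmxS -dplusEOE.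
set u := dcol _ _; set v := drow _ _; set w := _ + _.
have -> : u = 0 by exact: zero_src.
have -> : v = 0 by exact: zero_tgt.
rewrite -/(msum _ _) tau1_sum; [|exact: is_iso_dplusEO|exact: is_iso_zero].
by rewrite [X in _ + X]tau1_zero // addr0.
Qed.

Lemma dplusEO_nat C D (G : forall r, hom (C r) (C r.+1)) (H : forall r, hom (D r) (D r.+1))
    (phi : chmap C D) n :
  (forall r, H r \oc phi r = phi r.+1 \oc G r) ->
  dplusEO n H \oc dmap (fun i => phi i.*2.+1) n =
  dmap (fun i => phi i.*2) n \oc dplusEO n G.
Proof.
move=> hG; rewrite !dplusEOE dmx_dmap dmap_dmx; apply: eq_dmx => i j _ _.
rewrite compDl compDr; congr (_ + _).
  have [e|h] := eqVneq j.*2.+1 i.*2.+1; last by rewrite !d_at0 // comp0m compm0.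
  have -> : j = i by lia.
  by rewrite !d_atE cm_comm.
have [e|h] := eqVneq j.*2.+2 i.*2; last by rewrite !up_at0 // comp0m compm0.
have -> : i = j.+1 by lia.
by rewrite !(up_atE _ j.*2.+1) hG.
Qed.

(** A contraction of C is transported to D; the isomorphisms then intertwine the
two operators d + Gamma. *)
Lemma tau_iso C D (phi : chmap C D) N :
  (forall r, is_iso (phi r)) -> contractible C ->
  (clen C <= N)%N -> (clen D <= N)%N ->
  contractible D /\ tau D = tau C + altsum (fun r => tau1 (phi r)) N.
Proof.
move=> hphi [G hG] hC hD.
have hpsi r : exists psi, psi \oc phi r = idm _ /\ phi r \oc psi = idm _.
  by have [psi hpsi] := hphi r; exists psi.
pose psi r := sval (cid (hpsi r)).
have psiK r : psi r \oc phi r = idm _ by exact: (proj1 (svalP (cid (hpsi r)))).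
have phiK r : phi r \oc psi r = idm _ by exact: (proj2 (svalP (cid (hpsi r)))).
pose H r := phi r.+1 \oc G r \oc psi r.
have hH : contraction H.
  split=> [|r].
    by rewrite /H !compA cm_comm -(compA (phi 0%N)) (proj1 hG) compm1 phiK.
  rewrite /H !compA cm_comm -(compA _ (psi r)).
  have -> : psi r \oc cd D r = cd C r \oc psi r.+1.
    rewrite -[LHS]compm1 -(phiK r.+1) !compA -(compA (psi r)) cm_comm.
    by rewrite compA psiK comp1m.
  rewrite !compA -compDl -!(compA (phi _)) -compDr.
  by rewrite (proj2 hG) compm1 phiK.
split; first by exists H.
rewrite (tauE hG hC) (tauE hH hD).
have nat : dplusEO N H \oc dmap (fun i => phi i.*2.+1) N =
    dmap (fun i => phi i.*2) N \oc dplusEO N G.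
  by apply: dplusEO_nat => r; rewrite /H -!compA psiK compm1.
have i1 : is_iso (dmap (fun i => phi i.*2.+1) N) by apply: is_iso_dmap.
have i0 : is_iso (dmap (fun i => phi i.*2) N) by apply: is_iso_dmap.
have := congr1 (@tau1 _ _ _) nat.
rewrite (tau1_comp i1 (is_iso_dplusEO hD hH)) (tau1_comp (is_iso_dplusEO hC hG) i0).
rewrite !tau1_dmap // => e.
have -> : altsum (fun r => tau1 (phi r)) N = altsum (fun r => tau1 (phi r)) N.*2.
  rewrite [RHS](@altsum_stable _ _ N) //; last by lia.
  move=> r hr; apply: tau1_zero; apply: cfin; exact: leq_trans hr.
rewrite altsum_double addrA -e; zmodule.
Qed.

Fixpoint shuffle (F G : nat -> A) n :
    hom (dsum (fun i => F i \(+) G i) n) (dsum F n \(+) dsum G n) :=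
  if n is n'.+1 then mid4 _ _ _ _ \oc msum (shuffle F G n') (idm _) else 0.

Lemma is_iso_shuffle (F G : nat -> A) n : is_iso (shuffle F G n).
Proof.
have z := is_zero_zob A.
elim: n => [|n IH] /=; first by apply: is_iso_zero => //; exact: is_zero_osum.
by apply: is_iso_comp (is_iso_mid4 _ _ _ _) (is_iso_msum IH (is_iso_id _)).
Qed.

Lemma eps_dsuml (F : nat -> A) X n : eps (dsum F n) X = \sum_(i < n) eps (F i) X.
Proof.
elim: n => [|n IH]; first by rewrite big_ord0 eps_zerol //; exact: is_zero_zob.
by rewrite big_ord_recr /= epsDl IH.
Qed.

(** Each F i has to pass the G j with j < i. *)
Lemma tau1_shuffle (F G : nat -> A) n :
  tau1 (shuffle F G n) = \sum_(i < n) \sum_(j < i) eps (G j) (F i).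
Proof.
have z := is_zero_zob A.
elim: n => [|n IH]; first by rewrite big_ord0 tau1_zero //; exact: is_zero_osum.
have i1 := is_iso_id (F n \(+) G n); have is1 := is_iso_shuffle F G n.
rewrite big_ord_recr -IH /= (tau1_comp (is_iso_msum is1 i1) (is_iso_mid4 _ _ _ _)).
by rewrite tau1_sum // tau1_id addr0 tau1_mid4 eps_dsuml.
Qed.

Lemma prj1_msum X Y X' Y' (f : hom X X') (g : hom Y Y') :
  prj1 \oc msum f g = f \oc prj1.
Proof. by rewrite /msum /mx22 /row2 !catE. Qed.

Lemma prj2_msum X Y X' Y' (f : hom X X') (g : hom Y Y') :
  prj2 \oc msum f g = g \oc prj2.
Proof. by rewrite /msum /mx22 /row2 !catE. Qed.

Lemma prj1_shuffle (F G : nat -> A) n :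
  prj1 \oc shuffle F G n = dmap (fun i => prj1 : hom (F i \(+) G i) (F i)) n.
Proof.
elim: n => [|n IH] /=; first by rewrite compm0 idm_zob.
have e X Y Z T : prj1 \oc mid4 X Y Z T = msum prj1 prj1.
  by apply: sum_ext; rewrite /mid4 /row2 /msum /mx22 /row2 !catE.
by rewrite compA e /msum mx22M !catE -IH.
Qed.

Lemma prj2_shuffle (F G : nat -> A) n :
  prj2 \oc shuffle F G n = dmap (fun i => prj2 : hom (F i \(+) G i) (G i)) n.
Proof.
elim: n => [|n IH] /=; first by rewrite compm0 idm_zob.
have e X Y Z T : prj2 \oc mid4 X Y Z T = msum prj2 prj2.
  by apply: sum_ext; rewrite /mid4 /row2 /msum /mx22 /row2 !catE.
by rewrite compA e /msum mx22M !catE -IH.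
Qed.

Definition ch_prj1 C D : chmap (csum_cx C D) C :=
  @ChMap A (csum_cx C D) C (fun r => prj1) (fun r => esym (prj1_msum _ _)).
Definition ch_prj2 C D : chmap (csum_cx C D) D :=
  @ChMap A (csum_cx C D) D (fun r => prj2) (fun r => esym (prj2_msum _ _)).

Lemma beta_stable C D n : (clen C <= n)%N -> beta C D =
  \sum_(i < n) \sum_(j < i)
    (eps (C i.*2) (D j.*2) - eps (C i.*2.+1) (D j.*2.+1)).
Proof.
elim: n => [|n IH]; rewrite leq_eqVlt => /predU1P[e|]; rewrite ?ltn0 //.
- by rewrite /beta e.
- by rewrite /beta e.
rewrite ltnS => h; rewrite big_ord_recr -IH //= big1 ?addr0 // => j _.
rewrite !eps_zerol ?subrr //; apply: (@cfin _ C); lia.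
Qed.

(** The shuffles intertwine d + Gamma of the sum with the operators of the two
summands. Their torsions in even and in odd degrees differ by beta. *)
Lemma tau_csum C D : contractible C -> contractible D ->
  contractible (csum_cx C D) /\ tau (csum_cx C D) = tau C + tau D + beta C D.
Proof.
move=> [G hG] [H hH].
pose K r : hom (csum_cx C D r) (csum_cx C D r.+1) := msum (G r) (H r).
have hK : contraction K.
  split=> [|r]; rewrite /K /= /sum_d /msum !mx22M !catE.
    by rewrite (proj1 hG) (proj1 hH) mx22_1.
  by rewrite mx22D !addr0 (proj2 hG) (proj2 hH) mx22_1.
split; first by exists K.
pose n := maxn (clen C) (clen D).
have hC : (clen C <= n)%N by exact: leq_maxl.
have hD : (clen D <= n)%N by exact: leq_maxr.
rewrite (tauE hG hC) (tauE hH hD) (tauE hK (leqnn n)) (beta_stable D hC).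
pose So := shuffle (fun i => C i.*2.+1) (fun i => D i.*2.+1) n.
pose Se := shuffle (fun i => C i.*2) (fun i => D i.*2) n.
have e : Se \oc dplusEO n K = msum (dplusEO n G) (dplusEO n H) \oc So.
  apply: sum_coext; rewrite !compA ?prj1_msum ?prj2_msum -[RHS]compA.
    rewrite /Se /So !prj1_shuffle; symmetry.
    apply: (@dplusEO_nat _ _ _ _ (ch_prj1 C D)) => r; by rewrite prj1_msum.
  rewrite /Se /So !prj2_shuffle; symmetry.
  apply: (@dplusEO_nat _ _ _ _ (ch_prj2 C D)) => r; by rewrite prj2_msum.
have iG := is_iso_dplusEO hC hG; have iH := is_iso_dplusEO hD hH.
have iK : is_iso (dplusEO n K) by apply: is_iso_dplusEO hK; exact: leqnn.
have := congr1 (@tau1 _ _ _) e.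
rewrite (tau1_comp iK (is_iso_shuffle _ _ _)).
rewrite (tau1_comp (is_iso_shuffle _ _ _) (is_iso_msum iG iH)) (tau1_sum iG iH).
rewrite !tau1_shuffle => {}e.
have -> : \sum_(i < n) \sum_(j < i) (eps (C i.*2) (D j.*2) - eps (C i.*2.+1) (D j.*2.+1))
   = \sum_(i < n) \sum_(j < i) eps (D j.*2.+1) (C i.*2.+1)
   - \sum_(i < n) \sum_(j < i) eps (D j.*2) (C i.*2).
  rewrite -sumrB; apply: eq_bigr => i _; rewrite -sumrB; apply: eq_bigr => j _.
  by rewrite [eps (C _) (D _)]epsC [X in _ - X]epsC; zmodule.
rewrite -[LHS](addrK (\sum_(i < n) \sum_(j < i) eps (D j.*2) (C i.*2))) e.
zmodule.
Qed.

(** Forgets the summand F 0, which is a zero object in the intended case of a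
suspension. *)
Fixpoint dshift (F : nat -> A) n : hom (dsum F n.+1) (dsum (fun i => F i.+1) n) :=
  if n is n'.+1 then msum (dshift F n') (idm (F n'.+1)) else 0.

Lemma is_iso_dshift (F : nat -> A) n : is_zero (F 0%N) -> is_iso (dshift F n).
Proof.
move=> z0; have z := is_zero_zob A.
elim: n => [|n IH] /=; first by apply: is_iso_zero => //; exact: is_zero_osum.
by apply: is_iso_msum => //; exact: is_iso_id.
Qed.

Lemma tau1_dshift (F : nat -> A) n : is_zero (F 0%N) -> tau1 (dshift F n) = 0.
Proof.
move=> z0; have z := is_zero_zob A.
elim: n => [|n IH] /=; first by apply: tau1_zero => //; exact: is_zero_osum.
rewrite tau1_sum ?IH ?tau1_id ?addr0 //; last exact: is_iso_id.
exact: is_iso_dshift.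
Qed.

Lemma dshift_dcol (F : nat -> A) X (v : forall i, hom X (F i)) n :
  dshift F n \oc dcol v n.+1 = dcol (fun i => v i.+1) n.
Proof.
elim: n => [|n IH]; first by rewrite /= comp0m.
rewrite [in LHS]/= in IH *.
by rewrite compDr !compA msum_inj1 msum_inj2 -compA IH compm1.
Qed.

Lemma d_at_susp C r s : d_at (susp_cx C) r.+1 s.+1 = d_at C r s.
Proof.
have [->|h] := eqVneq r s.+1; last by rewrite !d_at0.
by rewrite (d_atE _ s) (d_atE (susp_cx C) s.+1).
Qed.

Definition susp_up C (G : forall r, hom (C r) (C r.+1)) r :
    hom (susp_cx C r) (susp_cx C r.+1) :=
  match r with 0 => 0 | r'.+1 => G r' end.

Lemma up_at_susp C (G : forall r, hom (C r) (C r.+1)) r s :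
  up_at (susp_up G) r.+1 s.+1 = up_at G r s.
Proof.
have [<-|h] := eqVneq r.+1 s; last by rewrite !up_at0.
by rewrite (up_atE G r) (up_atE (susp_up G) r.+1).
Qed.

(** Suspension exchanges the even and the odd part, and d + Gamma has opposite
torsions on the two parts. *)
Lemma tau_susp C : contractible C ->
  contractible (susp_cx C) /\ tau (susp_cx C) = - tau C.
Proof.
move=> [G hG]; have z := is_zero_zob A.
have hS : contraction (susp_up G).
  split=> [|[|r]] /=; first by rewrite comp0m idm_zob.
    by rewrite comp0m addr0 (proj1 hG).
  exact: (proj2 hG).
split; first by exists (susp_up G).
have [n [hC hSC]] : exists n, (clen C <= n)%N /\ (clen (susp_cx C) <= n.+1)%N.
  by exists (clen C).+1; rewrite /= !leqnSn.
rewrite (tauE hS hSC) (tauE hG hC) -(tau1_dplusOE hC hG hG).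
have zn : is_zero (C n.*2) by apply: (@cfin _ C); lia.
pose T := dshift (fun i => susp_ob C i.*2) n.
have e : T \oc dplusEO n.+1 (susp_up G) = dplusOE n G \oc prj1.
  rewrite dplusEOE dplusOEE /T /dmx comp_drow.
  pose m i j := d_at (susp_cx C) j.*2.+1 i.*2 + up_at (susp_up G) j.*2.+1 i.*2.
  transitivity (drow (fun j => dcol (fun i => m i.+1 j) n) n.+1).
    by apply: eq_drow => j _; exact: (dshift_dcol (fun i => m i j)).
  apply: sum_ext; rewrite /= /row2 !catE.
    apply: eq_drow => j _; apply: eq_dcol => i _.
    by rewrite /m (d_at_susp C j.*2) (up_at_susp G j.*2).
  exact: zero_src.
have iT : is_iso T by exact: is_iso_dshift.
have iS := is_iso_dplusEO hSC hS.
have := congr1 (@tau1 _ _ _) e.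
rewrite (tau1_comp iS iT) tau1_dshift // addr0 => ->.
rewrite (tau1_comp (is_iso_prj1 _ zn) (is_iso_dplusOE hC hG)) tau1_prj1 //.
by rewrite add0r.
Qed.

End Torsion.

(** * Short exact sequences *)

Section ShortExact.
Variable A : addCat.
Implicit Types (X Y Z T : A) (C D : complex A).

(** The condition that short_exact imposes in each degree. *)
Definition split_exact X Y Z (i : hom X Y) (j : hom Y Z) : Prop :=
  j \oc i = 0 /\ exists (l : hom Y X) (k : hom Z Y),
    [/\ l \oc i = idm X, j \oc k = idm Z & i \oc l + k \oc j = idm Y].

Lemma is_iso_row2 X Y Z (i : hom X Y) (j : hom Y Z) k :
  split_exact i j -> j \oc k = idm Z -> is_iso (row2 i k).
Proof.
case=> ji [l [k0 [li jk0 il]]] jk.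
have ei T (x : hom T Y) : j \oc x = 0 -> i \oc l \oc x = x.
  by move=> h; rewrite -[RHS]comp1m -il compDl -(compA k0) h compm0 addr0.
exists (inj1 \oc l \oc (idm Y - k \oc j) + inj2 \oc j); split.
  by apply: sum_ext; apply: sum_coext; rewrite /row2 !catE // -?(compA _ j) ?ji
    ?jk ?catE ?li ?subr0 ?subrr.
have e : i \oc l \oc (idm Y - k \oc j) = idm Y - k \oc j.
  by apply: ei; rewrite !catE jk comp1m subrr.
rewrite /row2 !catE -[in LHS](compA _ k).
by move: e; rewrite !catE => ->; rewrite subrK.
Qed.

(** Two sections differ by a map through i, so the two isomorphisms differ by an
elementary automorphism. *)
Lemma tau1_row2 X Y Z (i : hom X Y) (j : hom Y Z) k k' :
  split_exact i j -> j \oc k = idm Z -> j \oc k' = idm Z ->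
  tau1 (row2 i k) = tau1 (row2 i k').
Proof.
move=> hij jk jk'; have [ji [l [k0 [li jk0 il]]]] := hij.
have -> : row2 i k' = row2 i k \oc mx22 (idm X) (l \oc (k' - k)) 0 (idm Z).
  have e : k' = i \oc l \oc (k' - k) + k.
    have -> : i \oc l = idm Y - k0 \oc j by rewrite -il addrK.
    by rewrite !catE -!(compA _ j) jk jk'; zmodule.
  apply: sum_ext; rewrite -compA ?mx22_inj1 ?mx22_inj2 /row2 !catE //.
  by rewrite {1}e !catE.
rewrite tau1_comp ?tau1_upper ?add0r //; last exact: is_iso_row2 hij jk.
exists (mx22 (idm X) (- (l \oc (k' - k))) 0 (idm Z)).
by rewrite !mx22M !catE addNr subrr mx22_1.
Qed.

Lemma sectionP X Y (j : hom X Y) k : j \oc k = idm Y -> j \oc section j = idm Y.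
Proof.
move=> jk; rewrite /section; case: pselect => [h|[]]; last by exists k.
exact: projT2 (cid h).
Qed.

Lemma tauN_sesE (C C'' C' : scomplex A) (i : chmap C C'') (j : chmap C'' C')
    (k : forall r, hom (C' r) (C'' r)) N :
  short_exact i j -> (forall r, j r \oc k r = idm (C' r)) ->
  (clen C <= N)%N -> (clen C'' <= N)%N -> (clen C' <= N)%N ->
  tauN_ses i j =
    altsum (fun r => tau1 (row2 (i r) (k r))) N - eta_sum C C' + eta C''.
Proof.
move=> hij jk hC hC'' hC'.
have hz r : (maxn (maxn (clen C) (clen C')) (clen C'') <= r)%N ->
    tau1 (row2 (i r) (k r)) = 0.
  rewrite !geq_max => /andP[/andP[zC zC'] zC''].
  by apply: tau1_zero; [apply: is_zero_osum|]; exact: cfin.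
have hN : (maxn (maxn (clen C) (clen C')) (clen C'') <= N)%N.
  by rewrite !geq_max hC hC' hC''.
rewrite (altsum_stable hz hN) /tauN_ses /tauN_iso; do 2![congr (_ + _)].
apply: eq_bigr => r _; congr (_ *~ _).
by apply: tau1_row2 (hij r) _ (jk r); exact: sectionP (jk r).
Qed.

(** The map d + Gamma is an isomorphism from the odd part to the even part. *)
Lemma chi_contractible C : contractible C -> chi C = 0.
Proof.
case=> G hG; rewrite -[RHS]oppr0 -[LHS]opprK; congr (- _).
rewrite /chi opprB /cls /pgen -ppiB; apply: ppi_rel; apply: K0_iso.
by exists (dplusEO (clen C) G); apply: is_iso_dplusEO hG.
Qed.

(** When the quotient has a contraction G, the degreewise sections k0 can be
replaced by the chain map d k0 G + k0 G d, which j sends to d G + G d = 1. So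
C'' is isomorphic, as a complex, to the direct sum. There the term beta of
tau_csum cancels against the one of the sign, whose remaining correction
eps(C_odd, chi C') vanishes because chi C' = 0. *)
Lemma tauN_extension (C C'' C' : scomplex A) (i : chmap C C'') (j : chmap C'' C') :
  short_exact i j -> contractible C -> contractible C' ->
  contractible C'' /\ tauN C'' = tauN C + tauN C' + tauN_ses i j.
Proof.
move=> hij hC hC'; have [G [G0 GS]] := hC'.
have [k [jk kd]] : exists k : forall r, hom (C' r) (C'' r),
    (forall r, j r \oc k r = idm (C' r)) /\
    (forall r, cd C'' r \oc k r.+1 = k r \oc cd C' r).
  pose k0 r := section (j r).
  have jk0 r : j r \oc k0 r = idm (C' r).
    by have [_ [l [k [_ jk _]]]] := hij r; exact: sectionP jk.
  pose h r : hom (C' r) (C'' r.+1) := k0 r.+1 \oc G r.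
  exists (fun r => match r with
    | 0 => cd C'' 0 \oc h 0%N
    | r'.+1 => cd C'' r'.+1 \oc h r'.+1 + h r' \oc cd C' r'
    end); split=> [] [|r] /=; rewrite /h.
  - by rewrite !compA -cm_comm -(compA _ (j 1%N)) jk0 compm1 G0.
  - rewrite compDr !compA -cm_comm -(compA _ (j r.+2)) !jk0 compm1 comp1m; exact: GS.
  - by rewrite compDr !compA cdd !comp0m add0r.
  - by rewrite !(compDl, compDr) !compA cdd !comp0m add0r -(compA _ (cd C' r)) cdd compm0 addr0.
have comm r : cd C'' r \oc row2 (i r.+1) (k r.+1) = row2 (i r) (k r) \oc sum_d C C' r.
  by apply: sum_ext; rewrite /row2 /sum_d /msum /mx22 /row2 !catE ?cm_comm ?kd.
pose phi := @ChMap A (csum_cx C C') C'' (fun r => row2 (i r) (k r)) comm.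
have iphi r : is_iso (phi r) by exact: is_iso_row2 (hij r) (jk r).
have [hs ts] := tau_csum hC hC'.
pose N := maxn (maxn (clen C) (clen C')) (clen C'').
have [hC'' t''] := tau_iso iphi hs (leq_maxl _ _ : (_ <= N)%N) (leq_maxr _ _ : (_ <= N)%N).
split=> //.
rewrite (tauN_sesE (N := N) hij jk); first last.
- by rewrite /N; lia.
- by rewrite /N; lia.
- by rewrite /N; lia.
have chi0 := chi_contractible hC'.
have e00 x : eps0 x 0 = 0 :> K1 A by rewrite -(subrr 0) eps0Br subrr.
rewrite /tauN t'' ts /eta_sum chi0 e00.
rewrite -[altsum _ N in RHS]/(altsum (fun r => tau1 (phi r)) N).
zmodule.
Qed.

End ShortExact.

(** * The sign of a direct sum *)

Section Signs.
Variable A : addCat.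
Implicit Types (X Y Z T : A) (C D : complex A).

Lemma eps00r (x : K0 A) : eps0 x 0 = 0.
Proof. by rewrite -(subrr 0) eps0Br subrr. Qed.

Lemma eps0Nl (x y : K0 A) : eps0 (- x) y = - eps0 x y.
Proof. by rewrite -[- x]sub0r eps0Bl eps0_0l sub0r. Qed.

Lemma eps0Nr (x y : K0 A) : eps0 x (- y) = - eps0 x y.
Proof. by rewrite -[- y]sub0r eps0Br eps00r sub0r. Qed.

Lemma eps0Dl (x x' y : K0 A) : eps0 (x + x') y = eps0 x y + eps0 x' y.
Proof. by rewrite -{1}[x']opprK eps0Bl eps0Nl opprK. Qed.

Lemma eps0Dr (x y y' : K0 A) : eps0 x (y + y') = eps0 x y + eps0 x y'.
Proof. by rewrite -{1}[y']opprK eps0Br eps0Nr opprK. Qed.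

Lemma eps0_altl (f : nat -> K0 A) y N :
  eps0 (altsum f N) y = altsum (fun r => eps0 (f r) y) N.
Proof.
elim: N => [|N IH]; first by rewrite /altsum !big_ord0 eps0_0l.
rewrite /altsum !big_ord_recr /= eps0Dl -!/(altsum _ N) IH; congr (_ + _).
rewrite -signr_odd; case: (odd N); rewrite ?expr1 ?expr0 ?mulrNz !mulr1z //.
exact: eps0Nl.
Qed.

Lemma eps0_altr (f : nat -> K0 A) x N :
  eps0 x (altsum f N) = altsum (fun r => eps0 x (f r)) N.
Proof.
elim: N => [|N IH]; first by rewrite /altsum !big_ord0 eps00r.
rewrite /altsum !big_ord_recr /= eps0Dr -!/(altsum _ N) IH; congr (_ + _).
rewrite -signr_odd; case: (odd N); rewrite ?expr1 ?expr0 ?mulrNz !mulr1z //.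
exact: eps0Nr.
Qed.

Lemma cls_iso X Y : isomorphic X Y -> cls X = cls Y.
Proof.
move=> h; apply/eqP; rewrite -subr_eq0; apply/eqP.
by rewrite /cls /pgen -ppiB; apply/ppi_rel/K0_iso.
Qed.

Lemma cls_sum X Y : cls (X \(+) Y) = cls X + cls Y.
Proof. exact/pgen_sum/K0_sum. Qed.

Lemma cls_zero X : is_zero X -> cls X = 0.
Proof.
move=> hX; have e : isomorphic X (X \(+) X).
  by exists 0; apply: is_iso_zero => //; exact: is_zero_osum.
by have := cls_iso e; rewrite cls_sum -[LHS]addr0 => /addrI <-.
Qed.

Lemma cls_dsum (F : nat -> A) n : cls (dsum F n) = \sum_(i < n) cls (F i).
Proof.
elim: n => [|n IH]; first by rewrite big_ord0 cls_zero //; exact: is_zero_zob.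
by rewrite big_ord_recr /= cls_sum IH.
Qed.

Lemma chiE C N : (clen C <= N)%N -> chi C = altsum (fun r => cls (C r)) N.
Proof.
have h r : (clen C <= r)%N -> cls (C r) = 0 by move=> hr; apply/cls_zero/cfin.
move=> hN; rewrite (altsum_stable h hN) -(altsum_stable h (n := (clen C).*2)).
  by rewrite altsum_double /chi !cls_dsum.
by rewrite -addnn leq_addr.
Qed.

Lemma chi_susp C : chi (susp_cx C) = - chi C.
Proof.
rewrite (chiE (leqnn _)) altsum_shift /=; last by apply/cls_zero/is_zero_zob.
by rewrite (chiE (leqnn _)).
Qed.

Lemma chi_csum C D : chi (csum_cx C D) = chi C + chi D.
Proof.
rewrite (chiE (leqnn _)) (chiE (leq_maxl _ _ : (_ <= maxn (clen C) (clen D)))%N).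
rewrite (chiE (leq_maxr _ _ : (_ <= maxn (clen C) (clen D)))%N) -altsumD.
by apply: eq_altsum => r; exact: cls_sum.
Qed.

(** The part of the sign of a direct sum that is bilinear in the chain objects.
All sign computations reduce to its coefficients on the eps (C r) (D s), see
sum_signE. *)
Definition sum_sign C D : K1 A := eps0 (cls (codd C)) (chi D) - beta C D.

Lemma eta_sumE (C D : scomplex A) : eta_sum C D = eta C + eta D + sum_sign C D.
Proof. by rewrite /eta_sum /sum_sign; zmodule. Qed.

Definition eps_sum (c : nat -> nat -> int) (F G : nat -> A) N : K1 A :=
  \sum_(r < N) \sum_(s < N) eps (F r) (G s) *~ c r s.

(** The coefficients of sum_sign: eps(C_odd, chi D) contributes 1 or -1 when r
is odd, and beta contributes when r > s have the same parity. *)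
Definition sum_coef (r s : nat) : int :=
  if odd r then if odd s then - ((r <= s)%N : int) else 1
  else if odd s then 0 else - ((s < r)%N : int).

(** The coefficients of eps(chi C, chi D). *)
Definition chi_coef (r s : nat) : int := (-1) ^+ r * (-1) ^+ s.

Lemma eps_sum_stable c C D m n : (clen C <= m)%N -> (clen D <= m)%N -> (m <= n)%N ->
  eps_sum c C D n = eps_sum c C D m.
Proof.
move=> hC hD; elim: n => [|n IH]; first by case: m {hC hD}.
rewrite leq_eqVlt => /predU1P[-> //|]; rewrite ltnS => h.
rewrite [LHS]/eps_sum big_ord_recr /= [X in _ + X]big1 => [|s _]; last first.
  by rewrite eps_zerol ?mul0rz //; apply: cfin; exact: leq_trans h.
rewrite addr0 -(IH h); apply: eq_bigr => r _.
rewrite big_ord_recr /= eps_zeror ?mul0rz ?addr0 //.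
by apply: cfin; exact: leq_trans h.
Qed.

Lemma sum_double (V : zmodType) (f : nat -> V) n :
  \sum_(r < n.*2) f r = \sum_(i < n) (f i.*2 + f i.*2.+1).
Proof.
elim: n => [|n IH]; first by rewrite !big_ord0.
by rewrite doubleS !big_ord_recr /= IH addrA.
Qed.

Lemma sum_below (V : zmodType) (f : nat -> V) (i n : nat) : (i <= n)%N ->
  \sum_(j < i) f j = \sum_(j < n) f j *~ ((j < i)%N : int).
Proof.
move=> h; rewrite (big_ord_widen n f h) big_mkcond; apply: eq_bigr => j _.
by case: ifP.
Qed.

Lemma sum_signE C D N : (clen C <= N)%N -> (clen D <= N)%N -> sum_sign C D = eps_sum sum_coef C D N.
Proof.
move=> hC hD; have hN : (N <= N.*2)%N by rewrite -addnn leq_addr.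
rewrite -(eps_sum_stable sum_coef hC hD hN) /sum_sign (beta_stable D hC).
have -> : eps0 (cls (codd C)) (chi D) = \sum_(i < N) \sum_(j < N)
    (eps (C i.*2.+1) (D j.*2) - eps (C i.*2.+1) (D j.*2.+1)).
  have -> : cls (codd C) = \sum_(i < N) cls (C i.*2.+1).
    rewrite cls_dsum (big_ord_widen N (fun i => cls (C i.*2.+1)) hC) big_mkcond.
    apply: eq_bigr => i _; case: ifP => // /negbT; rewrite -leqNgt => h.
    by rewrite cls_zero //; apply: (@cfin _ C); lia.
  elim/big_rec2: _ => [|i u v _ <-]; first by rewrite eps0_0l.
  rewrite eps0Dl; congr (_ + _).
  rewrite (chiE (leq_trans hD hN)) eps0_altr altsum_double -sumrB.
  by apply: eq_bigr => j _; rewrite !eps0_cls.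
rewrite /eps_sum (sum_double (fun r => \sum_(s < N.*2) eps (C r) (D s) *~ sum_coef r s)).
rewrite -sumrB; apply: eq_bigr => i _.
rewrite !(sum_double (fun s => eps (C _) (D s) *~ sum_coef _ s)) (sum_below (fun j => eps (C i.*2) (D j.*2) -
  eps (C i.*2.+1) (D j.*2.+1)) (ltnW (ltn_ord i))).
rewrite -sumrB -big_split; apply: eq_bigr => j _.
rewrite /sum_coef /= !odd_double /= ltn_double ltnS leq_double (leqNgt i j).
by case: ltnP => _ /=; rewrite ?mulrNz ?mulr1z ?mulr0z; zmodule.
Qed.

Lemma eps0_chi C D N : (clen C <= N)%N -> (clen D <= N)%N ->
  eps0 (chi C) (chi D) = eps_sum chi_coef C D N.
Proof.
move=> hC hD; rewrite (chiE hC) (chiE hD) eps0_altl; apply: eq_bigr => r _.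
rewrite eps0_altr /altsum mulrz_suml; apply: eq_bigr => s _.
by rewrite eps0_cls /chi_coef mulrC mulrzA.
Qed.

Lemma eps_sumDl c (F F' G : nat -> A) N :
  eps_sum c (fun r => F r \(+) F' r) G N = eps_sum c F G N + eps_sum c F' G N.
Proof.
rewrite /eps_sum -big_split; apply: eq_bigr => r _; rewrite -big_split.
by apply: eq_bigr => s _; rewrite epsDl mulrzDl.
Qed.

Lemma eps_sumDr c (F G G' : nat -> A) N :
  eps_sum c F (fun r => G r \(+) G' r) N = eps_sum c F G N + eps_sum c F G' N.
Proof.
rewrite /eps_sum -big_split; apply: eq_bigr => r _; rewrite -big_split.
by apply: eq_bigr => s _; rewrite epsDr mulrzDl.
Qed.

Lemma sum_sign_csuml C C' D : sum_sign (csum_cx C C') D = sum_sign C D + sum_sign C' D.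
Proof.
pose N := maxn (maxn (clen C) (clen C')) (clen D).
rewrite !(@sum_signE _ _ N); try by rewrite /N /=; lia.
exact: eps_sumDl.
Qed.

Lemma sum_sign_csumr C D D' : sum_sign C (csum_cx D D') = sum_sign C D + sum_sign C D'.
Proof.
pose N := maxn (maxn (clen D) (clen D')) (clen C).
rewrite !(@sum_signE _ _ N); try by rewrite /N /=; lia.
exact: eps_sumDr.
Qed.

Lemma sum_sign_iso C C' D D' : (forall r, isomorphic (C r) (C' r)) ->
  (forall r, isomorphic (D r) (D' r)) -> sum_sign C D = sum_sign C' D'.
Proof.
move=> hC hD; pose N := maxn (maxn (clen D) (clen D')) (maxn (clen C) (clen C')).
rewrite !(@sum_signE _ _ N); try by rewrite /N /=; lia.
apply: eq_bigr => r _; apply: eq_bigr => s _.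
by rewrite (eps_iso (hC r) (hD s)).
Qed.

(** Both sides have the same coefficients: c(r+1, s+1) + c(r, s) = - (-1)^(r+s).
*)
Lemma sum_sign_susp C D : sum_sign (susp_cx C) (susp_cx D) + sum_sign C D = - eps0 (chi C) (chi D).
Proof.
pose N := maxn (clen C) (clen D).
rewrite (@sum_signE _ _ N.+1) ?(@sum_signE C D N) ?(@eps0_chi _ _ N) ?leq_maxl ?leq_maxr //;
  rewrite /= ?ltnS ?leq_maxl ?leq_maxr //.
have z := is_zero_zob A.
rewrite /eps_sum big_ord_recl big1 => [|s _]; last by rewrite eps_zerol ?mul0rz.
rewrite add0r -big_split -sumrN; apply: eq_bigr => r _.
rewrite big_ord_recl /= eps_zeror // mul0rz add0r -big_split -sumrN.
apply: eq_bigr => s _ /=; rewrite -mulrzDr -mulrNz; congr (_ *~ _).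
rewrite /bump /= !add1n /sum_coef /chi_coef /= -(signr_odd _ r) -(signr_odd _ s) !ltnS.
by case: (odd r); case: (odd s) => //=; rewrite (leqNgt r s); case: (s < r)%N.
Qed.

(** As eps is antisymmetric, this is the identity - c(s, r) - c(r, s) + (-1)^r
[r = s] = (-1)^(r+s) between coefficients. It says that exchanging C and D has
absolute torsion eps(chi C, chi D). *)
Lemma sum_sign_swap C D N : (clen C <= N)%N -> (clen D <= N)%N ->
  sum_sign D C - sum_sign C D + altsum (fun r => eps (C r) (D r)) N = eps0 (chi C) (chi D).
Proof.
move=> hC hD; rewrite (sum_signE hD hC) (sum_signE hC hD) (eps0_chi hC hD).
rewrite /eps_sum exchange_big -sumrB -big_split; apply: eq_bigr => r _ /=.
have -> : eps (C r) (D r) *~ (-1) ^+ r =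
    \sum_(s < N) eps (C r) (D s) *~ ((-1) ^+ r * (s == r)%:R).
  rewrite (bigD1 r) //= eqxx mulr1 big1 ?addr0 // => s /negbTE ->.
  by rewrite mulr0 mulr0z.
rewrite -sumrB -big_split; apply: eq_bigr => s _ /=.
rewrite (epsC (C r) (D s)) mulNrz -!mulrNz -!mulrzDr; congr (_ *~ _).
rewrite /sum_coef /chi_coef -(signr_odd _ r) -(signr_odd _ s).
have -> : (s == r) = (s == r :> nat) by [].
case: (ltngtP s r) => [h|h|->] /=; case: (odd r) => //; by case: (odd s).
Qed.

End Signs.

(** * Mapping cones *)

Section Cones.
Variable A : addCat.
Implicit Types (X Y Z T : A).

(** The isomorphism u = d G + G d commutes with d, so that the maps G u^-1 form
a contraction. *)
Lemma contractible_of_iso (C : complex A) (G : forall r, hom (C r) (C r.+1)) :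
  is_iso (cd C 0 \oc G 0%N) ->
  (forall r, is_iso (cd C r.+1 \oc G r.+1 + G r \oc cd C r)) -> contractible C.
Proof.
move=> i0 iS.
pose u r : hom (C r) (C r) :=
  match r with 0 => cd C 0 \oc G 0%N | r'.+1 => cd C r'.+1 \oc G r'.+1 + G r' \oc cd C r' end.
have iu r : exists v, v \oc u r = idm _ /\ u r \oc v = idm _ by case: r.
pose v r := sval (cid (iu r)).
have vu r : v r \oc u r = idm _ by exact: (proj1 (svalP (cid (iu r)))).
have uv r : u r \oc v r = idm _ by exact: (proj2 (svalP (cid (iu r)))).
have du r : cd C r \oc u r.+1 = u r \oc cd C r.
  case: r => [|r] /=; rewrite !(compDr, compDl) !compA cdd !comp0m add0r //.
  by rewrite -[in RHS](compA (G r)) cdd compm0 addr0.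
have vd r : v r \oc cd C r = cd C r \oc v r.+1.
  by rewrite -[LHS]compm1 -(uv r.+1) !compA -(compA (v r)) du compA vu comp1m.
exists (fun r => G r \oc v r); split=> [|r]; first by rewrite compA (uv 0%N).
by rewrite -compA vd !compA -compDl (uv r.+1).
Qed.

Lemma signz_cases r : (-1) ^+ r = (1%R : int) \/ (-1) ^+ r = ((-1)%R : int).
Proof. by rewrite -signr_odd; case: (odd r); [right|left]. Qed.

(** The matrix with diagonal entries -k and -h given by the two homotopies and
lower entry g, up to sign, is a contraction only up to the unipotent matrix with
upper entry f h - k f, up to sign. *)
Lemma cone_contractible (C D : complex A) (f : chmap C D) :
  chain_equiv f -> contractible (cone_cx f).
Proof.
case=> g [[h [h0 hS]] [k [k0 kS]]].
pose G r : hom (cone_cx f r) (cone_cx f r.+1) :=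
  mx22 (- k r) 0 (g r *~ (-1) ^+ r.+2)
    (match r return hom (susp_ob C r) (C r) with 0 => 0 | r'.+1 => - h r' end).
have iU X Y (x : hom Y X) : is_iso (mx22 (idm X) x 0 (idm Y)).
  exists (mx22 (idm X) (- x) 0 (idm Y)).
  by rewrite !mx22M !catE addNr subrr mx22_1.
have z := is_zero_zob A.
apply: (@contractible_of_iso _ G) => [|r].
  rewrite /G /= /cone_d mx22M.
  set x := _ + _; set y := _ + _; set w := _ + _; set t := _ + _.
  have -> : x = idm _.
    rewrite /x (_ : (-1) ^+ 2 = 1%R) // !mulr1z compmN -k0 /=.
    by zmodule.
  have -> : w = 0 by exact: zero_tgt.
  by have -> : t = idm zob by rewrite idm_zob; exact: zero_tgt.
rewrite /G /= /cone_d !mx22M mx22D /= [(-1) ^+ r.+3]exprS mulN1r.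
set x := _ + _; set y := _ + _; set w := _ + _; set t := _ + _.
have sgn2 X Y Z' (u : hom Y Z') (v : hom X Y) : u *~ (-1) ^+ r.+2 \oc (v *~ (-1) ^+ r.+2) = u \oc v.
  by case: (signz_cases r.+2) => ->; rewrite ?mulrNz !mulr1z ?compNm ?compmN ?opprK.
have sgnr X Y Z' (u : hom Y Z') (v : hom X Y) : u \oc (v *~ (-1) ^+ r.+2) = (u \oc v) *~ (-1) ^+ r.+2.
  by case: (signz_cases r.+2) => ->; rewrite ?mulrNz !mulr1z ?compmN.
have sgnl X Y Z' (u : hom Y Z') (v : hom X Y) : u *~ (-1) ^+ r.+2 \oc v = (u \oc v) *~ (-1) ^+ r.+2.
  by case: (signz_cases r.+2) => ->; rewrite ?mulrNz !mulr1z ?compNm.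
have -> : x = idm _.
  rewrite /x !mulrNz !compNm !compmN opprK sgn2 comp0m addr0.
  by have /= := kS r => /eqP; rewrite subr_eq => /eqP ->; zmodule.
have -> : w = 0.
  by rewrite /w comp0m compm0 add0r addr0 mulrNz compmN !sgnr sgnl cm_comm addNr.
have -> : t = idm _.
  rewrite /t comp0m add0r sgn2 compmN {x y w t sgn2 sgnr sgnl}; case: r => [|r] /=.
    by rewrite comp0m addr0 -h0 /=; zmodule.
  rewrite compNm; have /= := hS r; move/eqP; rewrite subr_eq => /eqP ->; zmodule.
exact: iU.
Qed.

Lemma tauN_susp (C : scomplex A) : contractible C -> tauN (susp C) = - tauN C.
Proof. by move=> hC; rewrite /tauN (proj2 (tau_susp hC)) /=; zmodule. Qed.

Definition ch_inj1 (C D : complex A) : chmap C (csum_cx C D) :=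
  @ChMap A C (csum_cx C D) (fun r => inj1) (fun r => msum_inj1 _ _).

Definition ch_inj2 (C D : complex A) : chmap D (csum_cx C D) :=
  @ChMap A D (csum_cx C D) (fun r => inj2) (fun r => msum_inj2 _ _).

Lemma split_exact_sum X Y : split_exact (inj1 : hom X (X \(+) Y)) prj2.
Proof.
by split; [exact: prj2_inj1|exists prj1, inj2; rewrite prj1_inj1 prj2_inj2 inj_prj].
Qed.

Lemma row2_inj X Y : row2 inj1 inj2 = idm (X \(+) Y).
Proof. exact: inj_prj. Qed.

Lemma altsum0 (V : zmodType) (f : nat -> V) n : (forall r, f r = 0) -> altsum f n = 0.
Proof. by move=> h; rewrite /altsum big1 // => r _; rewrite h mul0rz. Qed.

Lemma tauN_ses_sum (C C' : scomplex A) :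
  @tauN_ses A C (csum C C') C' (ch_inj1 C C') (ch_prj2 C C') = 0.
Proof.
pose N := maxn (clen C) (clen C').
rewrite (@tauN_sesE _ C (csum C C') C' _ _ (fun r => inj2) N) ?leq_maxl ?leq_maxr //.
- by rewrite altsum0 /=; [zmodule|move=> r; rewrite row2_inj tau1_id].
- by move=> r; exact: split_exact_sum.
- by move=> r; exact: prj2_inj2.
Qed.

(** The cone of f is an extension of the suspension of C by D whose terms are
the direct sums themselves. *)
Lemma tauN_map_contractible (C D : scomplex A) (f : chmap C D) :
  contractible C -> contractible D ->
  contractible (cone f) /\ tauN_map f = tauN D - tauN C.
Proof.
move=> hC hD.
have ci r : cd (cone_cx f) r \oc inj1 = inj1 \oc cd D r.
  by rewrite /= /cone_d mx22_inj1 compm0 addr0.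
have cp r : cd (susp_cx C) r \oc prj2 = prj2 \oc cd (cone_cx f) r.
  by rewrite /= /cone_d /mx22 /row2 !catE.
pose i := @ChMap A D (cone f) (fun r => inj1) ci.
pose j := @ChMap A (cone f) (susp C) (fun r => prj2) cp.
have hij : short_exact i j by move=> r; exact: split_exact_sum.
have [hSC _] := tau_susp hC.
have [h e] := tauN_extension (C'' := cone f) (C' := susp C) hij hD hSC.
split=> //; rewrite /tauN_map e tauN_susp //.
pose N := maxn (clen D) (clen C).+1.
rewrite (@tauN_sesE _ D (cone f) (susp C) _ _ (fun r => inj2) N) ?leq_maxl ?leq_maxr //.
- by rewrite altsum0 /=; [zmodule|move=> r; rewrite row2_inj tau1_id].
- by move=> r; exact: prj2_inj2.
Qed.

(** A homotopy, with signs, is the upper entry of an elementary isomorphism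
between the two cones. *)
Lemma tauN_map_homotopic (C D : scomplex A) (f g : chmap C D) :
  contractible (cone f) -> homotopic f g -> tauN_map f = tauN_map g.
Proof.
move=> hf [h [h0 hS]].
pose x r : hom (susp_ob C r) (D r) :=
  match r with 0 => 0 | r'.+1 => h r' *~ (-1) ^+ r'.+2 end.
have comm r : cone_d g r \oc mx22 (idm _) (x r.+1) 0 (idm _) =
    mx22 (idm _) (x r) 0 (idm _) \oc cone_d f r.
  rewrite /cone_d !mx22M !catE; congr (mx22 _ _ _ _).
  case: r => [|r] /=.
    rewrite comp0m addr0 (_ : (-1) ^+ 2 = (1%R : int)) // !mulr1z -h0; zmodule.
  have := hS r; rewrite [(-1) ^+ r.+3]exprS mulN1r.
  case: (signz_cases r.+2) => -> e; rewrite ?mulrNz ?mulr1z ?opprK ?compNm ?compmN ?opprK.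
    have -> : cd D r.+1 \oc h r.+1 = f r.+1 - g r.+1 - h r \oc cd C r by rewrite e addrK.
    zmodule.
  have -> : cd D r.+1 \oc h r.+1 = f r.+1 - g r.+1 - h r \oc cd C r by rewrite e addrK.
  zmodule.
pose w := @ChMap A (cone_cx f) (cone_cx g) _ comm.
have iw r : is_iso (w r).
  exists (mx22 (idm _) (- x r) 0 (idm _)).
  by rewrite /w /= !mx22M !catE addNr subrr mx22_1.
have [_ e] := tau_iso iw hf (leqnn _) (leqnn _).
rewrite /tauN_map /tauN [tau (cone g)]e altsum0 ?addr0 // => r.
exact: tau1_upper.
Qed.

Definition susp_hom (F G : nat -> A) (f : forall r, hom (F r) (G r)) r :
    hom (susp_ob F r) (susp_ob G r) :=
  match r with 0 => 0 | r'.+1 => f r' end.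

Lemma susp_split_exact (F G H : nat -> A) (i : forall r, hom (F r) (G r))
    (j : forall r, hom (G r) (H r)) :
  (forall r, split_exact (i r) (j r)) ->
  forall r, split_exact (susp_hom i r) (susp_hom j r).
Proof.
move=> h [|r] //=; split; first exact: comp0m.
by exists 0, 0; split; rewrite ?comp0m ?addr0 ?idm_zob.
Qed.

Lemma split_exact_msum X Y Z X' Y' Z' (i : hom X Y) (j : hom Y Z)
    (i' : hom X' Y') (j' : hom Y' Z') :
  split_exact i j -> split_exact i' j' -> split_exact (msum i i') (msum j j').
Proof.
case=> ji [l [k [li jk e]]] [ji' [l' [k' [li' jk' e']]]].
split; first by rewrite /msum mx22M !catE ji ji' mx22_0.
exists (msum l l'), (msum k k').
by rewrite /msum !mx22M !catE mx22D !addr0 li li' jk jk' e e' !mx22_1.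
Qed.

Section ConeMap.
Variables (C D C' D' : complex A) (f : chmap C D) (f' : chmap C' D').
Variables (u : chmap C C') (v : chmap D D').
Hypothesis sq : forall r, f' r \oc u r = v r \oc f r.

Lemma cone_map_comm r : cd (cone_cx f') r \oc msum (v r.+1) (susp_hom u r.+1) =
  msum (v r) (susp_hom u r) \oc cd (cone_cx f) r.
Proof.
rewrite /= /cone_d /msum !mx22M !catE cm_comm; congr (mx22 _ _ _ _).
  by case: (signz_cases r.+2) => ->; rewrite ?mulrNz !mulr1z ?compNm ?compmN sq.
by case: r => [|r] /=; rewrite ?comp0m // cm_comm.
Qed.

Definition cone_map : chmap (cone_cx f) (cone_cx f') :=
  @ChMap A (cone_cx f) (cone_cx f') (fun r => msum (v r) (susp_hom u r)) cone_map_comm.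
End ConeMap.

Lemma row2_msum X Y Z X' Y' Z' (i : hom X Y) (k : hom Z Y)
    (i' : hom X' Y') (k' : hom Z' Y') :
  row2 (msum i i') (msum k k') = msum (row2 i k) (row2 i' k') \oc mid4 _ _ _ _.
Proof.
by apply: sum_ext; apply: sum_ext; apply: sum_coext;
  rewrite /mid4 /msum /mx22 /row2 !catE.
Qed.

(** The cone of b is an extension of the cone of c by the cone of a. Degreewise
its splitting is that of the two rows, after the exchange of the summand Z' with
the suspension SX of X. The exchange and the signs contribute the terms of
sum_sign_swap for SX and Z' and of sum_sign_susp for X and Z; these cancel
because chi Z = chi Z' when c has a contractible cone. *)
Lemma tauN_map_extension (X Y Z X' Y' Z' : scomplex A)
    (i : chmap X Y) (j : chmap Y Z) (i' : chmap X' Y') (j' : chmap Y' Z')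
    (a : chmap X X') (b : chmap Y Y') (c : chmap Z Z') :
  short_exact i j -> short_exact i' j' ->
  (forall r, i' r \oc a r = b r \oc i r) ->
  (forall r, j' r \oc b r = c r \oc j r) ->
  contractible (cone a) -> contractible (cone c) ->
  tauN_map b = tauN_map a + tauN_map c - tauN_ses i j + tauN_ses i' j'.
Proof.
move=> hij hij' sa sc ha hc.
have [k jk] : exists k : forall r, hom (Z r) (Y r), forall r, j r \oc k r = idm _.
  exists (fun r => section (j r)) => r.
  by have [_ [l [k [_ h _]]]] := hij r; exact: sectionP h.
have [k' jk'] : exists k : forall r, hom (Z' r) (Y' r), forall r, j' r \oc k r = idm _.
  exists (fun r => section (j' r)) => r.
  by have [_ [l [k' [_ h _]]]] := hij' r; exact: sectionP h.
pose ci : chmap (cone a) (cone b) := cone_map (fun r => esym (sa r)).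
pose cj : chmap (cone b) (cone c) := cone_map (fun r => esym (sc r)).
have hc' : short_exact ci cj.
  by move=> r; apply: split_exact_msum (hij' r) _; exact: susp_split_exact.
have [_ e] := tauN_extension hc' ha hc.
pose M := maxn (maxn (clen X) (clen X')) (maxn (maxn (clen Y) (clen Y')) (maxn (clen Z) (clen Z'))).
have [X0 X0' Y0 Y0' Z0] : [/\ (clen X <= M)%N, (clen X' <= M)%N,
  (clen Y <= M)%N, (clen Y' <= M)%N & (clen Z <= M)%N] by rewrite /M; split; lia.
have Z0' : (clen Z' <= M)%N by rewrite /M; lia.
have isoY r : is_iso (row2 (i r) (k r)) by exact: is_iso_row2 (hij r) (jk r).
have isoY' r : is_iso (row2 (i' r) (k' r)) by exact: is_iso_row2 (hij' r) (jk' r).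
have zz := is_zero_zob A.
have isoS r : is_iso (row2 (susp_hom i r) (susp_hom k r)).
  by case: r => [|r] //=; apply: is_iso_zero => //; exact: is_zero_osum.
have e1 : tauN_ses ci cj = altsum (fun r => eps (susp_ob X r) (Z' r)) M.+1
    + altsum (fun r => tau1 (row2 (i' r) (k' r))) M
    - altsum (fun r => tau1 (row2 (i r) (k r))) M
    - eta_sum (cone a) (cone c) + eta (cone b).
  have jK r : cj r \oc msum (k' r) (susp_hom k r) = idm (cone c r).
    rewrite /cj /= /msum mx22M !catE jk' -[RHS]mx22_1; congr (mx22 _ _ _ _).
    by case: r => [|r] //=; rewrite ?comp0m ?idm_zob.
  rewrite (tauN_sesE (N := M.+1) hc' jK); try by rewrite /= geq_max ltnS; lia.
  congr (_ - _ + _).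
  have -> : altsum (fun r => tau1 (row2 (i' r) (k' r))) M =
      altsum (fun r => tau1 (row2 (i' r) (k' r))) M.+1.
    rewrite [RHS](@altsum_stable _ _ M) // => r hr.
    apply: tau1_zero; first apply: is_zero_osum; apply: cfin; exact: leq_trans hr.
  have -> : - altsum (fun r => tau1 (row2 (i r) (k r))) M =
      altsum (fun r => tau1 (row2 (susp_hom i r) (susp_hom k r))) M.+1.
    rewrite altsum_shift //=; apply: tau1_zero => //; exact: is_zero_osum.
  rewrite -!altsumD; apply: eq_altsum => r.
  rewrite /ci /= row2_msum.
  rewrite (tau1_comp (is_iso_mid4 _ _ _ _) (is_iso_msum (isoY' r) (isoS r))).
  by rewrite tau1_mid4 tau1_sum // addrA.
rewrite /tauN_map e e1 (tauN_sesE hij jk X0 Y0 Z0) (tauN_sesE hij' jk' X0' Y0' Z0').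
rewrite !eta_sumE /= !eta_sumE /=.
have -> : sum_sign (cone_cx a) (cone_cx c) =
    sum_sign X' Z' + sum_sign X' (susp_cx Z) + (sum_sign (susp_cx X) Z' + sum_sign (susp_cx X) (susp_cx Z)).
  by rewrite -!sum_sign_csumr -sum_sign_csuml.
have -> : sum_sign Y' (susp_cx Y) =
    sum_sign X' (susp_cx X) + sum_sign Z' (susp_cx X) + (sum_sign X' (susp_cx Z) + sum_sign Z' (susp_cx Z)).
  rewrite -!sum_sign_csuml -sum_sign_csumr; symmetry; apply: sum_sign_iso => r.
    by exists (row2 (i' r) (k' r)); exact: isoY'.
  by exists (row2 (susp_hom i r) (susp_hom k r)); exact: isoS.
have chiZ : chi Z' = chi Z.
  have := chi_contractible hc.
  rewrite -[chi _]/(chi (csum_cx Z' (susp_cx Z))) chi_csum chi_susp.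
  by move/eqP; rewrite subr_eq0 => /eqP.
have hs := @sum_sign_swap _ (susp_cx X) Z' M.+1 X0 (leqW Z0').
have hS := sum_sign_susp X Z.
(* hs and hS are now two expressions for the same pairing of chi X and chi Z. *)
rewrite chi_susp eps0Nl chiZ -hS /= in hs.
have -> : altsum (fun r => eps (susp_ob X r) (Z' r)) M.+1 =
    sum_sign (susp_cx X) (susp_cx Z) + sum_sign X Z - sum_sign Z' (susp_cx X) + sum_sign (susp_cx X) Z'.
  by rewrite -hs; zmodule.
zmodule.
Qed.

End Cones.

(** * Composition *)

Section Composition.
Variable A : addCat.
Implicit Types (X Y Z T : A).

Lemma homotopic_eq (C D : complex A) (f g : chmap C D) :
  (forall r, f r = g r) -> homotopic f g.
Proof.
move=> e; exists (fun r => 0); split=> [|r]; rewrite e subrr ?compm0 //.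
by rewrite comp0m addr0.
Qed.

Lemma chain_equiv_comp (C D E : complex A) (f : chmap C D) (g : chmap D E) :
  chain_equiv f -> chain_equiv g -> chain_equiv (chcomp g f).
Proof.
have comp_htpy (C' D' E' : complex A) (u : chmap C' D') (u' : chmap D' C')
    (w : chmap D' E') (w' : chmap E' D') :
    homotopic (chcomp u' u) (chid C') -> homotopic (chcomp w' w) (chid D') ->
    homotopic (chcomp (chcomp u' w') (chcomp w u)) (chid C').
  case=> h [h0 hS] [k [k0 kS]].
  exists (fun r => u' r.+1 \oc k r \oc u r + h r).
  have e r : chcomp (chcomp u' w') (chcomp w u) r - chid C' r =
      u' r \oc (chcomp w' w r - chid D' r) \oc u r + (chcomp u' u r - chid C' r).
    by rewrite /= !catE; zmodule.
  split=> [|r]; rewrite e.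
    by rewrite h0 k0 compDr !compA cm_comm.
  rewrite hS kS !(compDr, compDl) !compA cm_comm -!(compA _ (cd D' r)) cm_comm !compA.
  zmodule.
case=> f' [f1 f2] [g' [g1 g2]]; exists (chcomp f' g'); split; exact: comp_htpy.
Qed.

Lemma chain_equiv_id (C : complex A) : chain_equiv (chid C).
Proof. by exists (chid C); split; apply: homotopic_eq => r; rewrite /= comp1m. Qed.

Lemma chneg_comm (C : complex A) r :
  cd C r \oc - idm (C r.+1) = - idm (C r) \oc cd C r.
Proof. by rewrite compmN compNm compm1 comp1m. Qed.

Definition chneg (C : complex A) : chmap C C := ChMap (@chneg_comm C).

Lemma chain_equiv_neg (C : complex A) : chain_equiv (chneg C).
Proof.
by exists (chneg C); split; apply: homotopic_eq => r;
  rewrite /= compNm compmN opprK comp1m.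
Qed.

Lemma chi_equiv (C D : complex A) (f : chmap C D) :
  contractible (cone_cx f) -> chi D = chi C.
Proof.
move=> /chi_contractible.
rewrite -[chi _]/(chi (csum_cx D (susp_cx C))) chi_csum chi_susp.
by move/eqP; rewrite subr_eq0 => /eqP.
Qed.

(** A consequence of sum_sign_swap, read in both directions. *)
Lemma eps0_chiC (C D : complex A) : eps0 (chi D) (chi C) = - eps0 (chi C) (chi D).
Proof.
pose N := maxn (clen C) (clen D).
have hC : (clen C <= N)%N by exact: leq_maxl.
have hD : (clen D <= N)%N by exact: leq_maxr.
rewrite -(sum_sign_swap hC hD) -(sum_sign_swap hD hC).
have -> : altsum (fun r => eps (D r) (C r)) N = - altsum (fun r => eps (C r) (D r)) N.
  by rewrite /altsum -sumrN; apply: eq_bigr => r _; rewrite epsC mulNrz.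
zmodule.
Qed.

(** The chain map with matrix (f -1; 0 g) from C \(+) D to D \(+) E is
compatible with two pairs of filtrations. The evident ones have f and g on the
graded pieces. The graph of f in C \(+) D and the summand E in D \(+) E have g f
on the subcomplexes and -1 on the quotients; here the target contributes the
exchange of E and D, that is eps(chi E, chi D) = eps(chi D, chi D). *)
Lemma tauN_map_comp_neg (C D E : scomplex A) (f : chmap C D) (g : chmap D E) :
  contractible (cone f) -> contractible (cone g) -> contractible (cone (chcomp g f)) ->
  tauN_map f + tauN_map g = tauN_map (chcomp g f) +
    @tauN_map A D D (chneg D) + eps0 (chi D) (chi D).
Proof.
move=> hf hg hgf.
have hn : contractible (cone_cx (chneg D)) by exact/cone_contractible/chain_equiv_neg.
pose bm r : hom (C r \(+) D r) (D r \(+) E r) := mx22 (f r) (- idm _) 0 (g r).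
have bc r : sum_d D E r \oc bm r.+1 = bm r \oc sum_d C D r.
  by rewrite /bm /sum_d /msum !mx22M !catE !cm_comm.
pose b := @ChMap A (csum_cx C D) (csum_cx D E) bm bc.
have e1 := @tauN_map_extension A C (csum C D) D D (csum D E) E
  (ch_inj1 C D) (ch_prj2 C D) (ch_inj1 D E) (ch_prj2 D E) f b g
  (fun r => split_exact_sum _ _) (fun r => split_exact_sum _ _).
have {}e1 := e1 _ _ hf hg.
rewrite !tauN_ses_sum subr0 addr0 in e1.
rewrite -e1; first last.
- by move=> r; rewrite /= /bm /mx22 /row2 !catE.
- by move=> r; rewrite /= /bm mx22_inj1 compm0 addr0.
(* The graph of f, with quotient D. *)
pose im r : hom (C r) (C r \(+) D r) := inj1 + inj2 \oc f r.
have ic r : sum_d C D r \oc im r.+1 = im r \oc cd C r.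
  by rewrite /im /sum_d compDr compA msum_inj1 msum_inj2 -compA compDl -!compA cm_comm.
pose i := @ChMap A C (csum_cx C D) im ic.
pose jm r : hom (C r \(+) D r) (D r) := prj2 - f r \oc prj1.
have jc r : cd D r \oc jm r.+1 = jm r \oc sum_d C D r.
  rewrite /jm /sum_d compDr compmN [in RHS]compDl compNm prj2_msum -[in RHS]compA.
  by rewrite prj1_msum !compA cm_comm.
pose j := @ChMap A (csum_cx C D) D jm jc.
have hij : short_exact i j.
  move=> r; rewrite /= /jm /im; split; first by rewrite !catE subrr.
  exists prj1, inj2; rewrite !catE; split=> //.
  rewrite -inj_prj; zmodule.
have hij' : @short_exact A E (csum_cx D E) D (ch_inj2 D E) (ch_prj1 D E).
  move=> r; split; first exact: prj1_inj2.
  by exists prj2, inj1; rewrite prj1_inj1 prj2_inj2 addrC inj_prj.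
have e2 := @tauN_map_extension A C (csum C D) D E (csum D E) D i j
  (ch_inj2 D E) (ch_prj1 D E) (chcomp g f) b (chneg D) hij hij'.
have {}e2 := e2 _ _ hgf hn.
rewrite e2; first last.
- by move=> r; rewrite /= /bm /jm /mx22 /row2 !catE; zmodule.
- by move=> r; rewrite /= /bm /im /mx22 /row2 !catE; zmodule.
pose N := maxn (maxn (clen C) (clen D)) (clen E).
have nC : (clen C <= N)%N by rewrite /N; lia.
have nD : (clen D <= N)%N by rewrite /N; lia.
have nE : (clen E <= N)%N by rewrite /N; lia.
have nCD : (clen (csum C D) <= N)%N by rewrite /= geq_max nC nD.
have nDE : (clen (csum D E) <= N)%N by rewrite /= geq_max nD nE.
rewrite (@tauN_sesE A C (csum C D) D i j (fun r => inj2) N) //; last first.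
  by move=> r; rewrite /= /jm !catE.
rewrite (@tauN_sesE A E (csum D E) D (ch_inj2 D E) (ch_prj1 D E) (fun r => inj1) N) //;
  last by move=> r; exact: prj1_inj1.
rewrite [altsum (fun r => tau1 (row2 (i r) _)) N]altsum0 => [|r]; last first.
  rewrite -[RHS](tau1_lower (f r)); congr tau1.
  by apply: sum_ext; rewrite /i /= /im /mx22 /row2 !catE.
have -> : altsum (fun r => tau1 (row2 (ch_inj2 D E r) inj1)) N =
    altsum (fun r => eps (E r) (D r)) N.
  apply: eq_altsum => r; congr tau1.
  by apply: sum_ext; rewrite /swap /mx22 /row2 !catE.
have := sum_sign_swap nE nD; rewrite (chi_equiv hg) => <-.
rewrite /= !eta_sumE; zmodule.
Qed.

(** The preceding lemma for f = g = 1. *)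
Lemma tauN_map_neg (D : scomplex A) : @tauN_map A D D (chid D) =
  @tauN_map A D D (chneg D) + eps0 (chi D) (chi D).
Proof.
have i1 := chain_equiv_id D; have i11 := chain_equiv_comp i1 i1.
have := @tauN_map_comp_neg D D D (chid D) (chid D) (cone_contractible i1)
  (cone_contractible i1) (cone_contractible i11).
have -> : @tauN_map A D D (chcomp (chid D) (chid D)) = @tauN_map A D D (chid D).
  apply: tauN_map_homotopic; first exact: cone_contractible.
  by apply: homotopic_eq => r; rewrite /= comp1m.
by rewrite -[RHS]addrA => /addrI.
Qed.

Definition ob0 X r : A := if r is 0 then X else zob.

Lemma ob0_dd X r : (0 : hom (ob0 X r.+1) (ob0 X r)) \oc (0 : hom (ob0 X r.+2) _) = 0.
Proof. exact: comp0m. Qed.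

Lemma ob0_fin X r : (1 <= r)%N -> is_zero (ob0 X r).
Proof. by case: r => //= r _; exact: is_zero_zob. Qed.

Definition stalk0 X : complex A := Complex (@ob0_dd X) (@ob0_fin X).

Lemma in_im_eps0 : in_im_eps (0 : K1 A).
Proof. by exists [::]; rewrite big_nil. Qed.

Lemma tau_two_term (C : complex A) : (clen C <= 2)%N -> contractible C ->
  is_iso (cd C 0) -> tau C = tau1 (cd C 0).
Proof.
move=> h2 [G hG] i0; rewrite (tauE hG h2) dplusEOE.
have z := is_zero_zob A.
have z2 : is_zero (C 2) by exact: cfin.
have z3 : is_zero (C 3) by apply: cfin; exact: leqW.
rewrite dmxS [dmx _ 1]dmxS.
set x1 := dcol _ 1; set x2 := drow _ 1; set y3 := _ + _.
set y1 := dcol _ 0; set y2 := drow _ 0; set x3 := _ + _; set y0 := dmx _ 0.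
have -> : x1 = 0 by exact: zero_src.
have -> : x2 = 0 by exact: zero_tgt.
have -> : y3 = cd C 0 by rewrite /y3 (d_atE C 0) up_at0 // addr0.
have -> : y2 = 0 by exact: zero_src.
have -> : y1 = 0 by [].
have iz : is_iso y0 by exact: is_iso_zero.
have i3 : is_iso x3 by exact: is_iso_zero.
rewrite -!/(msum _ _) tau1_sum //; last exact: is_iso_msum.
by rewrite tau1_sum // (tau1_zero x3) // (tau1_zero y0) // addr0 add0r.
Qed.

Lemma tauN_id_stalk0 X (C := SComplex (stalk0 X) in_im_eps0) : @tauN_map A C C (chid C) = 0.
Proof.
have hc : contractible (cone_cx (chid C)) by exact/cone_contractible/chain_equiv_id.
have z := is_zero_zob A.
have e : cd (cone_cx (chid C)) 0 = swap zob X.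
  rewrite /= /cone_d /swap /= (_ : (-1) ^+ 2 = (1%R : int)) // mulr1z.
  by congr (mx22 _ _ _ _); rewrite [RHS]zero_src.
rewrite /tauN_map /tauN tau_two_term //; last by rewrite e; exact: is_iso_swap.
rewrite e -/(eps _ _) eps_zerol // add0r /= eta_sumE /= oppr0 !add0r.
rewrite /sum_sign /beta /= big_ord1 big_ord0 subr0.
by rewrite cls_zero ?eps0_0l //; exact: is_zero_osum.
Qed.

(** Because of the sign in the differential of a cone, the suspension of the
cone of the identity of D is the cone of -1 on SD, up to zero objects in degree
0. The corrections of sum_sign_susp and of tauN_map_neg add up to twice eps(chi
D, chi D), which is 0. *)
Lemma tauN_id_susp (D : scomplex A) :
  @tauN_map A D D (chid D) = 0 -> @tauN_map A (susp D) (susp D) (chid (susp D)) = 0.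
Proof.
move=> h0; set S := susp D.
have h1 : contractible (cone_cx (chid D)) by exact/cone_contractible/chain_equiv_id.
have e1 := tauN_map_neg S.
have z := is_zero_zob A.
pose psi r : hom (susp_cx (cone_cx (chid D)) r) (cone_cx (chneg S) r) :=
  match r with 0 => 0 | r'.+1 => idm _ end.
have psic r : cd (cone_cx (chneg S)) r \oc psi r.+1 =
    psi r \oc cd (susp_cx (cone_cx (chid D))) r.
  case: r => [|r].
    by rewrite [LHS]zero_tgt ?[RHS]zero_tgt //; exact: is_zero_osum.
  rewrite compm1 comp1m /= /cone_d /=; congr (mx22 _ _ _ _).
  by rewrite [(-1) ^+ r.+3]exprS mulN1r mulrNz mulNrz opprK.
pose psim := @ChMap A (susp_cx (cone_cx (chid D))) (cone_cx (chneg S)) psi psic.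
have ipsi r : is_iso (psim r).
  case: r => [|r]; last exact: is_iso_id.
  by apply: is_iso_zero => //; exact: is_zero_osum.
have [hs ts] := tau_susp h1.
have [_ tn] := tau_iso ipsi hs (leq_maxl _ _) (leq_maxr _ _).
have en : @tauN_map A S S (chneg S) = - @tauN_map A D D (chid D) + eps0 (chi D) (chi D).
  rewrite /tauN_map /tauN [tau (cone (chneg S))]tn ts altsum0 => [|[|r]]; last 2 first.
  - by apply: tau1_zero => //; exact: is_zero_osum.
  - exact: tau1_id.
  have := sum_sign_susp D S; rewrite /= !eta_sumE /= chi_susp eps0Nr opprK => <-.
  zmodule.
rewrite e1 en h0 oppr0 add0r /S /= chi_susp eps0Nl eps0Nr opprK.
by rewrite {2}(eps0_chiC D D) subrr.
Qed.

(** By induction on the length: D is an extension of the suspension of a shorter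
complex by its object of degree 0. Both can be given the sign 0, since the
absolute torsion of the extension cancels in tauN_map_extension. *)
Lemma tauN_id (D : scomplex A) : @tauN_map A D D (chid D) = 0.
Proof.
have [n] := ubnP (clen D); elim: n D => // n IH D hD.
have [h0|hpos] := posnP (clen D).
  have zD r : is_zero (D r) by apply: cfin; rewrite h0.
  have cD : contractible D.
    exists (fun r => 0); split=> [|r]; first by rewrite compm0 is_zero_idm.
    by rewrite compm0 comp0m addr0 is_zero_idm.
  by rewrite (proj2 (tauN_map_contractible _ cD cD)) subrr.
have fin' r : ((clen D).-1 <= r)%N -> is_zero (D r.+1) by move=> h; apply: cfin; lia.
pose D' := SComplex (@Complex A (fun r => D r.+1) (fun r => cd D r.+1)
  (fun r => cdd D r.+1) (clen D).-1 fin') in_im_eps0.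
pose D0 := SComplex (stalk0 (D 0%N)) in_im_eps0.
have s' : @tauN_map A D' D' (chid D') = 0 by apply: IH; rewrite /=; lia.
have z := is_zero_zob A.
pose im r : hom (ob0 (D 0%N) r) (D r) := match r with 0 => idm _ | _ => 0 end.
have ic r : cd D r \oc im r.+1 = im r \oc cd D0 r.
  by rewrite [LHS]zero_src ?[RHS]zero_src.
pose i := @ChMap A D0 D im ic.
pose jm r : hom (D r) (susp_ob D' r) := match r with 0 => 0 | _ => idm _ end.
have jc r : cd (susp_cx D') r \oc jm r.+1 = jm r \oc cd D r.
  case: r => [|r]; first by rewrite [LHS]zero_tgt ?[RHS]zero_tgt.
  by rewrite compm1 comp1m.
pose j := @ChMap A D (susp_cx D') jm jc.
have hij : short_exact i j.
  case=> [|r] /=; split; rewrite ?compm0 ?comp0m //.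
    exists (idm _), 0; rewrite /= comp1m !comp0m addr0 idm_zob; split=> //.
  exists 0, (idm _); rewrite /= comp1m !comp0m add0r idm_zob; split=> //.
have cid1 (C : complex A) : contractible (cone_cx (chid C)).
  exact/cone_contractible/chain_equiv_id.
have := @tauN_map_extension A D0 D (susp D') D0 D (susp D') i j i j
  (chid D0) (chid D) (chid (susp D')) hij hij.
rewrite tauN_id_stalk0 tauN_id_susp // => -> //; first by zmodule.
- by move=> r; rewrite /= compm1 comp1m.
- by move=> r; rewrite /= compm1 comp1m.
- exact: cid1.
- exact: cid1.
Qed.

(** By tauN_map_comp_neg and tauN_map_neg the two sides differ by the absolute
torsion of the identity of D. *)
Lemma tauN_map_comp (C D E : scomplex A) (f : chmap C D) (g : chmap D E) :
  chain_equiv f -> chain_equiv g ->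
  tauN_map (chcomp g f) = tauN_map f + tauN_map g.
Proof.
move=> hf hg; have hgf := chain_equiv_comp hf hg.
have -> := tauN_map_comp_neg (cone_contractible hf) (cone_contractible hg)
  (cone_contractible hgf).
by rewrite -[RHS]addrA -tauN_map_neg tauN_id addr0.
Qed.

End Composition.

(** * The properties of absolute torsion *)

Theorem proposition13 (A : addCat) :
  (* composition *)
  (forall (C D E : scomplex A) (f : chmap C D) (g : chmap D E),
      chain_equiv f -> chain_equiv g ->
      tauN_map (chcomp g f) = tauN_map f + tauN_map g)
  /\
  (* contractible complexes *)
  (forall (C D : scomplex A) (f : chmap C D),
      contractible C -> contractible D ->
      tauN_map f = tauN D - tauN C)
  /\
  (* homotopy invariance *)
  (forall (C D : scomplex A) (f g : chmap C D),
      chain_equiv f -> homotopic f g -> tauN_map f = tauN_map g)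
  /\
  (* morphisms of short exact sequences *)
  (forall (X Y Z X' Y' Z' : scomplex A)
      (i : chmap X Y) (j : chmap Y Z) (i' : chmap X' Y') (j' : chmap Y' Z')
      (a : chmap X X') (b : chmap Y Y') (c : chmap Z Z'),
      short_exact i j -> short_exact i' j' ->
      (forall r, i' r \oc a r = b r \oc i r) ->
      (forall r, j' r \oc b r = c r \oc j r) ->
      chain_equiv a -> chain_equiv b -> chain_equiv c ->
      tauN_map b =
        tauN_map a + tauN_map c - tauN_ses i j + tauN_ses i' j')
  /\
  (* direct sums *)
  (forall (C D C' D' : scomplex A) (f : chmap C D) (f' : chmap C' D'),
      chain_equiv f -> chain_equiv f' ->
      @tauN_map A (csum C C') (csum D D') (chsum f f')
        = tauN_map f + tauN_map f')
  /\
  (* short exact sequences with contractible quotient *)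
  (forall (X Y Z : scomplex A) (f : chmap X Y) (g : chmap Y Z),
      short_exact f g -> contractible Z -> chain_equiv f ->
      tauN_map f = tauN_ses f g + tauN Z).
Proof.
split; first exact: tauN_map_comp.
split; first by move=> C D f hC hD; exact: (proj2 (tauN_map_contractible f hC hD)).
split; first by move=> C D f g hf; apply: tauN_map_homotopic; exact: cone_contractible.
split.
  move=> X Y Z X' Y' Z' i j i' j' a b c hij hij' sa sc ha hb hc.
  by apply: tauN_map_extension => //; exact: cone_contractible.
split.
  move=> C D C' D' f f' hf hf'.
  have := @tauN_map_extension A C (csum C C') C' D (csum D D') D'
    (ch_inj1 C C') (ch_prj2 C C') (ch_inj1 D D') (ch_prj2 D D') f (chsum f f') f'
    (fun r => split_exact_sum _ _) (fun r => split_exact_sum _ _).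
  rewrite !tauN_ses_sum subr0 addr0; apply=> [r|r||].
  - by rewrite /= msum_inj1.
  - by rewrite /= prj2_msum.
  - exact: cone_contractible.
  - exact: cone_contractible.
move=> X Y Z f g hfg hZ hf.
have z := is_zero_zob A.
pose O : scomplex A := SComplex (stalk0 zob) (in_im_eps0 A).
have zO r : is_zero (O r) by case: r.
have null (C D : complex A) r :
    cd D r \oc (0 : hom (C r.+1) (D r.+1)) = (0 : hom (C r) (D r)) \oc cd C r.
  by rewrite compm0 comp0m.
pose j := @ChMap A X O (fun r => 0) (null X O).
pose c := @ChMap A O Z (fun r => 0) (null O Z).
have hO : contractible O.
  exists (fun r => 0); split=> [|r]; first by rewrite compm0 is_zero_idm.
  by rewrite compm0 comp0m addr0 is_zero_idm.
have [hc ec] := tauN_map_contractible c hO hZ.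
have hij : short_exact (chid X) j.
  move=> r; split; first exact: comp0m.
  exists (idm _), 0; split; first exact: comp1m.
    by rewrite compm0 is_zero_idm.
  by rewrite comp0m addr0; exact: comp1m.
have tO : tauN O = 0.
  rewrite /tauN addr0; have [G hG] := hO; rewrite (tauE hG (leqnn _)).
  by apply: tau1_zero; apply: is_zero_osum; [exact: z|exact: zO|exact: z|exact: zO].
have -> := @tauN_map_extension A X X O X Y Z (chid X) j f g (chid X) f c hij hfg
  (fun r => etrans (compm1 _) (esym (compm1 _))) _
  (cone_contractible (chain_equiv_id X)) hc.
  rewrite tauN_id ec tO.
  rewrite (@tauN_sesE A X X O (chid X) j (fun r => 0) (maxn (clen X) 1)) ?leq_maxl ?leq_maxr //.
    rewrite altsum0 => [|r]; last first.
      have -> : row2 (chid X r) 0 = prj1 :> hom (X r \(+) O r) (X r).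
        by rewrite /row2 comp1m comp0m addr0.
      exact: tau1_prj1.
    rewrite eta_sumE (@sum_signE _ X O (maxn (clen X) 1)) ?leq_maxl ?leq_maxr //.
    rewrite /eps_sum big1 => [|r _]; last first.
      by rewrite big1 // => s _; rewrite eps_zeror ?mul0rz.
    rewrite /=; zmodule.
  by move=> r; rewrite comp0m is_zero_idm.
by move=> r; rewrite comp0m; have [] := hfg r.
Qed.
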